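(* Let $n,t$ be positive integers. Let $\mu\subseteq\lambda$ be partitions with $l(\lambda)\le tn$, and let $a=(a_1,\dots,a_{tn})$, $b=(b_1,\dots,b_{tn})$ be flags with all $a_i, b_i \in t\mathbb{Z}$. Then $$\phi_t\big(s_{\lambda / \mu}(a,b)\big) = \epsilon_t(\lambda / \mu) \prod_{r=0}^{t-1} s_{\lambda^{(r)}/\mu^{(r)}}\left(a^{(r)}, b^{(r)}\right),$$ where, writing $m_r := m_r(\lambda)$ and $M_r := m_0+\cdots+m_{r-1}$, $$t\cdot a^{(r)} = \left(a_{\sigma_{\mu}(M_r+1)}, \dots, a_{\sigma_{\mu}(M_r+m_r)}\right),\qquad t\cdot b^{(r)} = \left(b_{\sigma_{\lambda}(M_r+1)}, \dots, b_{\sigma_{\lambda}(M_r+m_r)}\right).$$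
   Context: A flag is a weakly increasing sequence of non-negative integers. For partitions $\mu\subseteq\lambda$ and flags $a,b$, $\mathrm{Tab}(\lambda/\mu;a,b)$ is the set of semistandard skew tableaux $T$ of shape $\lambda/\mu$ (rows weakly increasing left to right, columns strictly increasing top to bottom, positive integer entries) such that $a_i < T_{ij} \le b_i$ for every box $(i,j)$ in row $i$, column $j$. The flagged skew Schur polynomial is $s_{\lambda/\mu}(a,b) := \sum_{T\in \mathrm{Tab}(\lambda/\mu;a,b)} x^{wt(T)}$, where $x^{wt(T)}=\prod_i x_i^{\#\{\text{entries equal to } i\}}$; by convention $s_{\lambda/\mu}(a,b):=0$ if $\mu\not\subseteq\lambda$. Let $\omega$ be a primitive $t$-th root of unity and $y_1,y_2,\dots$ variables with $y_i^t=x_i$ (so $\mathbb{C}[[x_1,x_2,\dots]]\cong\mathbb{C}[[y_1^t,y_2^t,\dots]]$). The map $\phi_t$ sends $f(x_1,x_2,\dots)$ to $f(y_1,\omega y_1,\dots,\omega^{t-1}y_1,\,y_2,\omega y_2,\dots,\omega^{t-1}y_2,\dots)$, the result being read as a series in $x_i=y_i^t$. For a partition $\lambda$ with at most $tn$ parts, $\beta(\lambda):=(\lambda_1+tn-1,\lambda_2+tn-2,\dots,\lambda_{tn}+0)$, and $m_r(\lambda)$ ($0\le r\le t-1$) is the number of entries of $\beta(\lambda)$ congruent to $r$ mod $t$. $\sigma_\lambda\in\mathfrak S_{tn}$ is the unique permutation such that for each $r$ and each $j$ with $m_0(\lambda)+\dots+m_{r-1}(\lambda)+1\le j\le m_0(\lambda)+\dots+m_r(\lambda)$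 one has $\beta(\lambda)_{\sigma_\lambda(j)}\equiv r \pmod t$, and within each such block the values $\beta(\lambda)_{\sigma_\lambda(j)}$ are strictly decreasing in $j$. The $t$-quotient $(\lambda^{(0)},\dots,\lambda^{(t-1)})$ is given by: $\lambda^{(r)}$ is the partition with $m_r(\lambda)$ parts (possibly zero) such that if $\beta(\lambda)_i$ is the $k$-th largest entry of $\beta(\lambda)$ congruent to $r$ mod $t$, then $(\beta(\lambda)_i - r)/t = \lambda^{(r)}_k + m_r(\lambda) - k$. $\mathrm{core}_t(\lambda)$ denotes the $t$-core of $\lambda$; for partitions with at most $tn$ parts, $\mathrm{core}_t(\lambda)=\mathrm{core}_t(\mu)$ iff $m_r(\lambda)=m_r(\mu)$ for all $r$. Finally $\epsilon_t(\lambda/\mu):=\delta_{\mathrm{core}_t(\lambda),\mathrm{core}_t(\mu)}\,\mathrm{sgn}(\sigma_\lambda)\,\mathrm{sgn}(\sigma_\mu)$, with $\delta$ the Kronecker delta. *)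

(* Defs.v *)
From HB Require Import structures.
From mathcomp Require Import all_boot all_order all_fingroup all_algebra finmap zify.
From mathcomp.multinomials Require Import monalg.

Set Implicit Arguments.
Unset Strict Implicit.
Unset Printing Implicit Defensive.

Import GRing.Theory.
Local Open Scope ring_scope.

(* The ring of polynomials over C in the variables x_1, x_2, ...              *)
(* Variables are numbered from 0: [pvar C i] is the variable x_(i+1).         *)
Notation inf_poly C := {malg C[{cmonom nat}]}.

Definition pvar (C : comNzRingType) (i : nat) : inf_poly C := << ucm i >>.

(* Substitution of v i for the variable [pvar C i], fixing the scalars.       *)
Definition cm_eval (C : comNzRingType) (v : nat -> inf_poly C)
    (m : {cmonom nat}) : inf_poly C :=
  \prod_(i <- finsupp m) v i ^+ m i.

Definition psubst (C : comNzRingType) (v : nat -> inf_poly C) :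
    inf_poly C -> inf_poly C :=
  mmap (fun c : C => c%:MP) (cm_eval v).

Section Substitution.
Variables (C : comNzRingType) (v : nat -> inf_poly C).

Lemma cm_evalEw (d : {fset nat}) (m : {cmonom nat}) :
  (finsupp m `<=` d)%fset -> cm_eval v m = \prod_(i <- d) v i ^+ m i.
Proof.
move=> sub; rewrite /cm_eval (big_fset_incl _ sub) //= => i _.
by rewrite memNfinsupp => /eqP ->; rewrite expr0.
Qed.

Lemma cm_eval_is_mmorphism : mmorphism (cm_eval v).
Proof.
split=> [m1 m2 |]; last first.
  rewrite (@cm_evalEw fset0) ?big_seq_fset0 //.
  by apply/fsubsetP=> i; rewrite mem_finsupp [X in X != _]onecmE eqxx.
pose d := (finsupp m1 `|` finsupp m2)%fset.
rewrite (@cm_evalEw d m1) ?fsubsetUl // (@cm_evalEw d m2) ?fsubsetUr //.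
rewrite (@cm_evalEw d) -?big_split /=; first apply: eq_bigr => i _.
  by rewrite [X in v i ^+ X]mulcmE exprD.
apply/fsubsetP=> i; rewrite in_fsetU !mem_finsupp [X in X != _]mulcmE.
by rewrite addn_eq0 negb_and.
Qed.

HB.instance Definition _ :=
  monalg.isMultiplicative.Build _ _ (cm_eval v) cm_eval_is_mmorphism.

Lemma psubst_scalar (c : C) : psubst v c%:MP = c%:MP.
Proof. by rewrite /psubst mmapC. Qed.

Lemma psubst_var (i : nat) : psubst v (pvar C i) = v i.
Proof.
rewrite /psubst mmapU mul1r (@cm_evalEw [fset i]%fset).
  by rewrite big_seq_fset1 [X in _ ^+ X]ucmE eqxx expr1.
apply/fsubsetP=> j; rewrite mem_finsupp [X in X != _]ucmE in_fset1.
by case: (eqVneq i j).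
Qed.

End Substitution.

(* phi_t, with values in the polynomials in y_1, y_2, ...: the variables      *)
(* x_(k t + 1), ..., x_(k t + t) become y_(k+1), omega y_(k+1), ...,          *)
(* omega^(t-1) y_(k+1).                                                       *)
Definition phi (C : comNzRingType) (t : nat) (omega : C) :
    inf_poly C -> inf_poly C :=
  psubst (fun i => omega ^+ (i %% t) *: pvar C (i %/ t)).

(* The identification x_i = y_i^t of C[x_1, x_2, ...] with                    *)
(* C[y_1^t, y_2^t, ...], the latter inside C[y_1, y_2, ...].                  *)
Definition x_to_y (C : comNzRingType) (t : nat) : inf_poly C -> inf_poly C :=
  psubst (fun i => pvar C i ^+ t).

Local Open Scope nat_scope.

(* Partitions are weakly decreasing sequences, possibly with trailing zeros.  *)
(* Rows are numbered from 0: row i of la has length nth 0 la i.               *)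
Definition is_partition (la : seq nat) : bool := sorted geq la.

Definition num_parts (la : seq nat) : nat := count (leq 1) la.

Definition part_incl (mu la : seq nat) : bool :=
  all (fun i => nth 0 mu i <= nth 0 la i) (iota 0 (size mu)).

Definition is_flag (a : seq nat) : bool := sorted leq a.

(* The boxes of la/mu.                                                        *)
Definition skew_box (la mu : seq nat) : finType :=
  {p : 'I_(size la) * 'I_(\max_(l <- la) l)
     | nth 0 mu p.1 <= p.2 < nth 0 la p.1}.

Definition brow (la mu : seq nat) (u : skew_box la mu) : nat := (val u).1.
Definition bcol (la mu : seq nat) (u : skew_box la mu) : nat := (val u).2.

(* The entries of a tableau in Tab(la/mu; a, b) are at most max b, so such    *)
(* tableaux form a finite type.                                               *)
Definition filling (la mu b : seq nat) : finType :=
  {ffun skew_box la mu -> 'I_(\max_(x <- b) x).+1}.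

Definition Tab (la mu a b : seq nat) : {set filling la mu b} :=
  [set T : filling la mu b |
   [&& [forall u, nth 0 a (brow u) < T u <= nth 0 b (brow u)],
       [forall u, forall v,
          (brow u == brow v) && (bcol u < bcol v) ==> (T u <= T v)]
     & [forall u, forall v,
          (bcol u == bcol v) && (brow u < brow v) ==> (T u < T v)]]].

(* An entry e >= 1 contributes x_e, which is [pvar C e.-1].                   *)
Definition flagged_schur (C : comNzRingType) (la mu a b : seq nat) :
    inf_poly C :=
  if part_incl mu la then
    (\sum_(T in Tab la mu a b) \prod_(u : skew_box la mu) pvar C (T u).-1)%R
  else 0%R.

(* In the rest of the file N stands for t * n.                                *)

Definition beta (N : nat) (la : seq nat) : seq nat :=
  mkseq (fun i => nth 0 la i + (N - i.+1)) N.

Definition mres (t N : nat) (la : seq nat) (r : nat) : nat :=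
  count (fun x => x %% t == r) (beta N la).

(* M_r = m_0 + ... + m_(r-1)                                                  *)
Definition Mres (t N : nat) (la : seq nat) (r : nat) : nat :=
  \sum_(q < r) mres t N la q.

Definition in_block (t N : nat) (la : seq nat) (r j : nat) : bool :=
  Mres t N la r <= j < Mres t N la r + mres t N la r.

Definition sigma_spec (t N : nat) (la : seq nat) (s : 'S_N) : bool :=
  [forall r : 'I_t,
    [forall j : 'I_N, in_block t N la r j ==>
       (nth 0 (beta N la) (s j) %% t == r)] &&
    [forall j : 'I_N, forall k : 'I_N,
       [&& in_block t N la r j, in_block t N la r k & j < k] ==>
       (nth 0 (beta N la) (s k) < nth 0 (beta N la) (s j))]].

(* The default value is never used when la is a partition and 0 < t: by       *)
(* [sigmaP] and [sigma_uniq] below, exactly one permutation satisfies         *)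
(* [sigma_spec].                                                              *)
Definition sigma (t N : nat) (la : seq nat) : 'S_N :=
  odflt 1%g [pick s | sigma_spec t la s].

(* t-quotient. If x is the k-th largest (k counted from 0) entry of beta that *)
(* is congruent to r mod t, then (x - r) / t = x %/ t, and this is at least   *)
(* m_r - (k + 1) since the entries of beta are distinct, so that the          *)
(* truncated subtraction is exact.                                            *)
Definition tquotient (t N : nat) (la : seq nat) (r : nat) : seq nat :=
  let xs := [seq x <- beta N la | x %% t == r] in
  mkseq (fun k => nth 0 xs k %/ t - (mres t N la r - k.+1)) (mres t N la r).

(* t-core, after Macdonald (Symmetric Functions and Hall Polynomials, I.1,    *)
(* Example 8): its set of beta-numbers is {t s + r | r < t, s < m_r}. See     *)
(* also [tcore_eqP] below.                                                    *)
Definition tcore_beta (t N : nat) (la : seq nat) : seq nat :=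
  sort geq [seq t * s + r | r <- iota 0 t, s <- iota 0 (mres t N la r)].

Definition tcore (t N : nat) (la : seq nat) : seq nat :=
  mkseq (fun i => nth 0 (tcore_beta t N la) i - (N - i.+1)) N.

Definition epsilon (t N : nat) (la mu : seq nat) : int :=
  ((tcore t N la == tcore t N mu)%:R
     * (-1) ^+ sigma t N la * (-1) ^+ sigma t N mu)%R.

(* The sequence (c_(s(M_r + 1)), ..., c_(s(M_r + m_r))) / t, where M_r and    *)
(* m_r are those of la.                                                       *)
Definition flag_block (t N : nat) (la : seq nat) (s : 'S_N) (c : N.-tuple nat)
    (r : nat) : seq nat :=
  [seq tnth c (s j) %/ t | j : 'I_N <- enum 'I_N & in_block t N la r j].

Section BetaNumbers.
Variables (t N : nat) (la : seq nat).
Hypothesis t_gt0 : 0 < t.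
Local Notation B := (beta N la).

Let block r := [seq j : 'I_N <- enum 'I_N | nth 0 B j %% t == r].

Lemma mres_block r : mres t N la r = size (block r).
Proof.
rewrite size_filter /mres -{1}[B](mkseq_nth 0) /mkseq count_map size_map size_iota.
by rewrite -val_enum_ord count_map.
Qed.

Let L := flatten [seq block r | r <- iota 0 t].

Lemma perm_L : perm_eq L (enum 'I_N).
Proof.
apply: uniq_perm => [||j]; last 2 first.
- exact: enum_uniq.
- rewrite mem_enum; apply/flatten_mapP; exists (nth 0 B j %% t).
    by rewrite mem_iota /= ltn_mod.
  by rewrite mem_filter eqxx mem_enum.
suff H (s : seq nat) : uniq s -> uniq (flatten [seq block r | r <- s]).
  by apply: H; rewrite iota_uniq.
elim: s => //= r s IH /andP[rs us]; rewrite cat_uniq IH // filter_uniq ?enum_uniq //=.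
rewrite andbT; apply/hasPn => j /flatten_mapP[q qs].
rewrite !mem_filter => /andP[/eqP -> _]; apply/negP => /andP[/eqP eq_qr _].
by rewrite -eq_qr qs in rs.
Qed.

Lemma Mres_sumn r : Mres t N la r = size (flatten [seq block q | q <- iota 0 r]).
Proof.
rewrite /Mres -(big_mkord xpredT (mres t N la)) /index_iota subn0.
rewrite size_flatten /shape -map_comp sumnE big_map.
by apply: eq_bigr => q _; rewrite mres_block.
Qed.

Lemma iota_split r : r < t -> iota 0 t = iota 0 r ++ r :: iota r.+1 (t - r.+1).
Proof. by move=> lt_r; have {1}-> : t = r + (t - r.+1).+1; [lia | rewrite iotaD]. Qed.

Lemma nth_L j0 r j : r < t -> in_block t N la r j ->
  nth j0 L j = nth j0 (block r) (j - Mres t N la r).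
Proof.
move=> lt_r /andP[le_j lt_j].
rewrite /L (iota_split lt_r) map_cat flatten_cat nth_cat -Mres_sumn.
rewrite ltnNge le_j /= nth_cat -mres_block.
by have -> : j - Mres t N la r < mres t N la r by lia.
Qed.

Let size_L : size L = N.
Proof. by rewrite (perm_size perm_L) size_enum_ord. Qed.

Lemma size_tcore_beta : size (tcore_beta t N la) = N.
Proof.
rewrite size_sort size_allpairs_dep -[RHS]size_L /L size_flatten /shape -map_comp.
by congr sumn; apply: eq_map => r; rewrite /= size_iota mres_block.
Qed.

Lemma mem_tcore_beta s r : r < t ->
  (t * s + r \in tcore_beta t N la) = (s < mres t N la r).
Proof.
move=> lt_r; rewrite mem_sort; apply/allpairsPdep/idP; last first.
  by move=> lt_s; exists r, s; rewrite !mem_iota.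
case=> r' [s' []]; rewrite !mem_iota !add0n /= => lt_r' lt_s' E.
have Er : r = r' by have := congr1 (modn^~ t) E; rewrite ![t * _]mulnC !modnMDl !modn_small.
move: E; rewrite Er => /addIn /eqP; rewrite eqn_pmul2l // => /eqP ->.
by [].
Qed.

Lemma tcore_beta_ge i : i < N -> N - i.+1 <= nth 0 (tcore_beta t N la) i.
Proof.
have uL : uniq (tcore_beta t N la).
  rewrite sort_uniq; apply: allpairs_uniq_dep => [|r _|]; try exact: iota_uniq.
  move=> _ _ /allpairsPdep[r [s [h1 _ ->]]] /allpairsPdep[r' [s' [h3 _ ->]]] /=.
  move: h1 h3; rewrite !mem_iota /= => h1 h3 E.
  have Er : r = r' by have := congr1 (modn^~ t) E; rewrite ![t * _]mulnC !modnMDl !modn_small.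
  by move: E; rewrite Er => /addIn /eqP; rewrite eqn_pmul2l // => /eqP ->.
have sL : sorted geq (tcore_beta t N la) by apply: sort_sorted => x y; exact: leq_total.
have dec j : j.+1 < N -> nth 0 (tcore_beta t N la) j.+1 < nth 0 (tcore_beta t N la) j.
  move=> lt_j; rewrite ltn_neqAle nth_uniq ?size_tcore_beta ?(ltnW lt_j) //.
  rewrite eqn_leq ltnn /=.
  apply: (sorted_leq_nth _ _ 0 sL); rewrite ?inE ?size_tcore_beta ?(ltnW lt_j) //.
    by move=> y x z /= h1 h2; apply: leq_trans h2 h1.
  by move=> x /=.
have [k] := ubnP (N - i.+1); elim: k i => // k IH i lt_k lt_i.
case: (ltnP i.+1 N) => [lt_i1|]; last by lia.
have := IH i.+1; have := dec i lt_i1; lia.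
Qed.
Hypothesis la_part : is_partition la.

Lemma nth_partition i j : i <= j -> nth 0 la j <= nth 0 la i.
Proof.
move=> le_ij; case: (ltnP j (size la)) => [lt_j|?]; last by rewrite (nth_default _ _).
by apply: (sorted_leq_nth _ _ 0 la_part); rewrite ?inE ?(leq_ltn_trans le_ij) //;
   [move=> y x z /= h1 h2; apply: leq_trans h2 h1 | move=> x /=].
Qed.

Lemma beta_decr i j : i < j < N -> nth 0 B j < nth 0 B i.
Proof.
case/andP=> lt_ij lt_j; rewrite !nth_mkseq ?(ltn_trans lt_ij) //.
by have := nth_partition (ltnW lt_ij); lia.
Qed.

Lemma beta_lt (i j : 'I_N) : (nth 0 B j < nth 0 B i) = (i < j).
Proof.
case: (ltngtP i j) => [ij|ji|/val_inj ->]; last by rewrite ltnn.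
  by rewrite beta_decr ?ij /=.
by apply/negbTE; rewrite -leqNgt ltnW // beta_decr ?ji /=.
Qed.

Let sf (j : 'I_N) := nth j L j.

Let sf_inj : injective sf.
Proof.
move=> i j; rewrite /sf (set_nth_default j i) ?size_L //.
move/eqP; rewrite nth_uniq ?size_L //; first by move/eqP/val_inj.
by rewrite (perm_uniq perm_L) enum_uniq.
Qed.

Lemma sigmaP : sigma_spec t la (sigma t N la).
Proof.
rewrite /sigma; case: pickP => //= /(_ (perm sf_inj)) /negbT /negP[].
apply/forallP=> r; apply/andP; split.
  apply/forallP=> j; apply/implyP=> Bj; rewrite permE /sf (@nth_L _ r) //.
  suff: nth j (block r) (j - Mres t N la r) \in block r by rewrite mem_filter => /andP[].
  case/andP: Bj => h1 h2; rewrite mem_nth // -mres_block; lia.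
apply/forallP=> j; apply/forallP=> k; apply/implyP=> /and3P[Bj Bk ljk].
rewrite !permE /sf !(@nth_L _ r) // (set_nth_default j k); last first.
  by case/andP: Bk => h1 h2; rewrite -mres_block; lia.
rewrite beta_lt.
have srt : sorted (fun x y : 'I_N => x < y) (block r).
  apply: sorted_filter => [y x z /=|]; first exact: ltn_trans.
  by have := iota_ltn_sorted 0 N; rewrite -val_enum_ord sorted_map.
apply: (sorted_ltn_nth _ j srt) => [y x z /=|||]; rewrite ?inE -?mres_block.
- exact: ltn_trans.
- by case/andP: Bj => h1 h2; lia.
- by case/andP: Bk => h1 h2; lia.
by case/andP: Bj => h1 h2; lia.
Qed.

Lemma in_block_ex (j : 'I_N) : exists r : 'I_t, in_block t N la r j.
Proof.
have: j < Mres t N la t by rewrite Mres_sumn -/L size_L.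
move=> H; pose P r := j < Mres t N la r.
case: (@ex_minnP P); first by exists t.
move=> [|r] Pr mn; first by move: Pr; rewrite /P /Mres big_ord0.
have lr : r < t by apply: mn.
exists (Ordinal lr); rewrite /in_block /=.
apply/andP; split; last by move: Pr; rewrite /P /Mres big_ord_recr.
by rewrite leqNgt; apply/negP => /mn; rewrite ltnn.
Qed.

Lemma sigma_uniq (s : 'S_N) : sigma_spec t la s -> s = sigma t N la.
Proof.
have key (s1 : 'S_N) (r : 'I_t) : sigma_spec t la s1 ->
    [seq s1 j | j : 'I_N <- enum 'I_N & in_block t N la r j] = block r.
  move=> /forallP/(_ r)/andP[/forallP h1 /forallP h2].
  have srtE : sorted (fun x y : 'I_N => x < y) (enum 'I_N).
    by have := iota_ltn_sorted 0 N; rewrite -val_enum_ord sorted_map.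
  have tr : transitive (fun x y : 'I_N => x < y) by move=> y x z /=; exact: ltn_trans.
  apply: (irr_sorted_eq tr) => [x|||]; first by rewrite /= ltnn.
  - rewrite sorted_map sorted_pairwise //; last by move=> ? ? ? /=; apply: ltn_trans.
    have := sorted_filter tr (fun j : 'I_N => in_block t N la r j) srtE.
    rewrite sorted_pairwise //.
    apply: (sub_in_pairwise (P := fun j : 'I_N => in_block t N la r j)); last exact: filter_all.
    move=> j k; rewrite /in_mem /= => Bj Bk jk.
    by rewrite -beta_lt; have /forallP/(_ k)/implyP := h2 j; apply; apply/and3P.
  - exact: sorted_filter.
  have: {subset [seq s1 j | j : 'I_N <- enum 'I_N & in_block t N la r j] <= block r}.
    move=> i /mapP[j]; rewrite mem_filter => /andP[Bj _] ->.
    by rewrite mem_filter mem_enum andbT; have /implyP := h1 j; apply.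
  move=> sub; apply: (uniq_min_size _ sub _).2.
    by rewrite map_inj_uniq; [rewrite filter_uniq ?enum_uniq | exact: perm_inj].
  rewrite size_map -mres_block size_filter.
  have -> : count (fun j : 'I_N => in_block t N la r j) (enum 'I_N)
     = count (in_block t N la r) (iota 0 N).
    by rewrite -val_enum_ord count_map.
  have leN : Mres t N la r + mres t N la r <= N.
    rewrite -[X in _ <= X]size_L Mres_sumn mres_block /L (iota_split (ltn_ord r)).
    by rewrite map_cat flatten_cat /= !size_cat leq_add2l leq_addr.
  have -> : iota 0 N = iota 0 (Mres t N la r) ++ iota (Mres t N la r) (mres t N la r)
     ++ iota (Mres t N la r + mres t N la r) (N - (Mres t N la r + mres t N la r)).
    have {1}-> : N = Mres t N la r + (mres t N la r + (N - (Mres t N la r + mres t N la r))).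
      by lia.
    by rewrite !iotaD.
  rewrite !count_cat; apply: leq_trans (leq_addl _ _); apply: leq_trans (leq_addr _ _).
  have /eqP -> : count (in_block t N la r) (iota (Mres t N la r) (mres t N la r)) ==
      size (iota (Mres t N la r) (mres t N la r)).
    by rewrite -all_count; apply/allP => x; rewrite mem_iota.
  by rewrite size_iota.
move=> Hs; apply/permP => j; have [r Bj] := in_block_ex j.
have jin : j \in [seq j : 'I_N <- enum 'I_N | in_block t N la r j].
  by rewrite mem_filter Bj mem_enum.
have := key _ r Hs; rewrite -(key _ r sigmaP) => /eq_in_map; exact.
Qed.

End BetaNumbers.

Lemma tcore_eqP (t N : nat) (la mu : seq nat) : 0 < t ->
  tcore t N la = tcore t N mu <->
  forall r, r < t -> mres t N la r = mres t N mu r.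
Proof.
move=> t_gt0; split=> [E r lt_r | E]; last first.
  have EL : tcore_beta t N la = tcore_beta t N mu.
    rewrite /tcore_beta; congr sort; congr flatten; apply/eq_in_map => r.
    by rewrite mem_iota add0n /= => lt_r; rewrite E.
  by rewrite /tcore EL.
have EL : tcore_beta t N la = tcore_beta t N mu.
  apply: (@eq_from_nth _ 0) => [|i]; rewrite !size_tcore_beta // => lt_i.
  have := congr1 (nth 0 ^~ i) E; rewrite !nth_mkseq //.
  have := @tcore_beta_ge t N la t_gt0 i lt_i.
  have := @tcore_beta_ge t N mu t_gt0 i lt_i; lia.
have H s := etrans (esym (@mem_tcore_beta t N la t_gt0 s r lt_r))
   (etrans (congr1 (fun x => t * s + r \in x) EL) (@mem_tcore_beta t N mu t_gt0 s r lt_r)).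
have := H (mres t N la r); have := H (mres t N mu r); rewrite !ltnn.
by case: ltngtP.
Qed.

(* Main.v *)
From HB Require Import structures.
Require Import Defs.
From mathcomp Require Import all_boot all_order all_fingroup all_algebra finmap zify.
From mathcomp.multinomials Require Import monalg.

Set Implicit Arguments.
Unset Strict Implicit.
Unset Printing Implicit Defensive.

Import GRing.Theory.
Local Open Scope ring_scope.

(* By the flagged Jacobi-Trudi formula, s_(la/mu)(a, b) is the determinant of  *)
(* the h_(l_i - m_j)(x_(a_j + 1), ..., x_(b_i)), with l and m the beta numbers *)
(* of la and mu. This formula is proved by induction on the largest admissible *)
(* entry: removing the boxes with that entry, a horizontal strip, from a       *)
(* tableau corresponds on the determinant to row operations followed by        *)
(* multilinear expansion over the interlacing labels.                          *)
(* Since the product of the 1 - omega^i y z over i < t is 1 - y^t z^t, phi_t   *)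
(* kills h_k unless t divides k, and then replaces it by h_(k/t) in the x_i.   *)
(* Hence only entries with l_i = m_j mod t survive; sorting the rows by        *)
(* sigma_la and the columns by sigma_mu yields a block diagonal matrix, whose  *)
(* blocks are the Jacobi-Trudi matrices of the t-quotients. If the cores       *)
(* differ, no permutation matches the residues and the determinant vanishes.   *)

(** * Flagged determinants of complete symmetric polynomials *)

(** Two facts carry the argument: the flagged Jacobi-Trudi formula [flagged_schur_det], and
    [phi_hdiff], the effect of [phi] on a single matrix entry. In the Jacobi-Trudi matrix, row i
    carries the label l_i and the upper flag b_i, while column j carries m_j and the lower flag a_j.
    This is why b ends up permuted by sigma_la and a by sigma_mu.

    The formula comes from [rect_jacobi_trudi]: the tableau sum ([rtab_sumS]) and the determinant
    ([det_hmatS]) satisfy the same recursion in the largest admissible entry.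

    Since t divides the flags, the alphabet of each entry is a union of full blocks of t variables,
    which [phi] turns into y, omega y, ..., omega^(t-1) y. [hsym_fold] computes the complete
    symmetric polynomials of such an alphabet. [det_residue_mx] then extracts the sign and the
    diagonal blocks, and [flagged_schur_tquotient] recognises each block by applying the
    Jacobi-Trudi formula to the t-quotients. *)

Section CompleteSymmetric.
Variables (R : comNzRingType) (x : nat -> R).

(* [hsym a b k] is h_k(x_(a+1), ..., x_b), where x_(i+1) is [x i]; [hdiff a b p q] *)
(* is h_(p-q), to be read as 0 for p < q.                                     *)
Fixpoint hsym (a b k : nat) : R :=
  if b is b'.+1 then
    if (a <= b')%N then \sum_(m < k.+1) x b' ^+ (k - m) * hsym a b' m
    else (k == 0%N)%:R
  else (k == 0%N)%:R.

Definition hdiff (a b p q : nat) : R :=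
  if (q <= p)%N then hsym a b (p - q) else 0.

Lemma hsym_empty a b k : (b <= a)%N -> hsym a b k = (k == 0%N)%:R.
Proof. by case: b => //= b; rewrite ltnNge => /negbTE ->. Qed.

Lemma hsymS a b k : (a <= b)%N ->
  hsym a b.+1 k = \sum_(m < k.+1) x b ^+ (k - m) * hsym a b m.
Proof. by move=> /= ->. Qed.

Lemma hdiff_empty a b p q : (b <= a)%N -> hdiff a b p q = (p == q)%:R.
Proof.
move=> le_ba; rewrite /hdiff hsym_empty // subn_eq0 eqn_leq.
by case: leqP => _; rewrite ?andbF ?andbT.
Qed.

Lemma hdiff_lt a b p q : (p < q)%N -> hdiff a b p q = 0.
Proof. by rewrite /hdiff ltnNge => /negbTE ->. Qed.

(** The coefficients and the range of n involve neither q nor a, so that the expansion applies to a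
    whole row of the determinant at once; the terms with n < q vanish by the convention for
    [hdiff]. *)
Lemma hdiffS a b p q : (a <= b)%N ->
  hdiff a b.+1 p q = \sum_(n < p.+1) x b ^+ (p - n) * hdiff a b n q.
Proof.
move=> le_ab; case: (leqP q p) => [le_qp|lt_pq]; last first.
  by rewrite hdiff_lt // big1 // => n _; rewrite hdiff_lt ?mulr0 // (leq_trans (ltn_ord n)).
rewrite /hdiff le_qp hsymS //.
rewrite -(big_mkord xpredT (fun m => x b ^+ (p - q - m) * hsym a b m)).
rewrite -(big_mkord xpredT (fun n => x b ^+ (p - n) * if (q <= n)%N then hsym a b (n - q) else 0)).
rewrite [RHS](@big_cat_nat _ _ _ q) //=; last exact: leqW.
rewrite [X in _ = X + _]big1_seq ?add0r; last first.
  by move=> n /=; rewrite mem_index_iota /= => lt_nq; rewrite leqNgt lt_nq mulr0.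
rewrite -[X in _ = \sum_(X <= _ < _) _]add0n big_addn subSn //.
by apply: eq_bigr => m _; rewrite leq_addl addnK addnC subnDA.
Qed.

End CompleteSymmetric.

Lemma eq_hsym (R : comNzRingType) (x y : nat -> R) a b k :
  x =1 y -> hsym x a b k = hsym y a b k.
Proof.
move=> E; elim: b k => //= b IH k; case: ifP => // _.
by apply: eq_bigr => i _; rewrite E IH.
Qed.

Lemma eq_hdiff (R : comNzRingType) (x y : nat -> R) a b p q :
  x =1 y -> hdiff x a b p q = hdiff y a b p q.
Proof. by move=> E; rewrite /hdiff (eq_hsym _ _ _ E). Qed.

Lemma rmorph_hsym (R S : comNzRingType) (f : {rmorphism R -> S}) x a b k :
  f (hsym x a b k) = hsym (f \o x) a b k.
Proof.
elim: b k => [|b IH] k /=; first by rewrite rmorph_nat.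
case: ifP => _; last by rewrite rmorph_nat.
by rewrite rmorph_sum; apply: eq_bigr => m _; rewrite rmorphM rmorphXn IH.
Qed.

Lemma rmorph_hdiff (R S : comNzRingType) (f : {rmorphism R -> S}) x a b p q :
  f (hdiff x a b p q) = hdiff (f \o x) a b p q.
Proof. by rewrite /hdiff; case: ifP => _; rewrite ?rmorph_hsym ?rmorph0. Qed.

(** * Recursion for the determinant in the largest admissible entry *)

Section DetRecursion.
Variables (R : comNzRingType) (x : nat -> R) (N W : nat).
Variables (m a b : 'I_N -> nat).
Hypothesis m_dec : forall i j : 'I_N, (i < j -> m j < m i)%N.
Hypothesis a_inc : forall i j : 'I_N, (i <= j -> a i <= a j)%N.
Hypothesis b_inc : forall i j : 'I_N, (i <= j -> b i <= b j)%N.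

(** The upper flags are capped at B, matching tableaux with entries at most B; once B bounds all the
    b_i this is the full Jacobi-Trudi matrix. *)
Definition hmat (B : nat) (l : 'I_N -> nat) : 'M[R]_N :=
  \matrix_(i, j) hdiff x (a j) (minn (b i) B) (l i) (m j).

(** The flags allow the entry B + 1, whose variable is [x B], in row i. *)
Definition active (B : nat) (i : 'I_N) : bool := (a i <= B < b i)%N.

(* In terms of the labels l_i = lambda_i + N - i, a subshape with labels n      *)
(* differs from the shape by a horizontal strip iff l_(i+1) < n_i <= l_i.      *)
Definition strip (B : nat) (l : 'I_N -> nat) (i : 'I_N) (k : nat) : bool :=
  if active B i then (k <= l i)%N && [forall j : 'I_N, (i < j)%N ==> (l j < k)%N]
  else k == l i.

(** Take the last i with l_i different from m_i; monotonicity of a gives B <= a_i. If l_i < m_i, row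
    i is zero, and if l_i > m_i, column i is zero: entries with an empty alphabet are Kronecker
    deltas, and the later labels of l and m agree. *)
Lemma det_hmat_eq0 B l i0 : (forall i j : 'I_N, (i < j -> l j < l i)%N) ->
  (B <= a i0)%N -> l i0 != m i0 -> \det (hmat B l) = 0.
Proof.
move=> l_dec le_B ne0; case: (@arg_maxnP _ i0 (fun i => l i != m i) val ne0).
move=> i ne_i max_i.
have le_Bi : (B <= a i)%N by apply: leq_trans le_B (a_inc (max_i _ ne0)).
have eq_gt (j : 'I_N) : (i < j)%N -> l j = m j.
  by move=> lt_ij; apply/eqP; apply: contraLR lt_ij => /max_i; rewrite -leqNgt.
case: (ltngtP (l i) (m i)) => [lt_lm | lt_ml | E]; last by rewrite E eqxx in ne_i.
  rewrite (expand_det_row _ i) big1 // => j _; rewrite !mxE.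
  case: (leqP j i) => [le_ji | lt_ij].
    rewrite hdiff_lt ?mul0r // (leq_trans lt_lm) //.
    by case: ltngtP le_ji => // [/m_dec/ltnW|/val_inj ->].
  rewrite hdiff_empty; first by rewrite -(eq_gt _ lt_ij) gtn_eqF ?mul0r // l_dec.
  by rewrite geq_min (leq_trans le_Bi) ?orbT // a_inc // ltnW.
rewrite (expand_det_col _ i) big1 // => j _; rewrite !mxE.
rewrite hdiff_empty ?geq_min ?le_Bi ?orbT //.
case: (ltngtP i j) => [lt_ij | lt_ji | /val_inj <-]; last by rewrite gtn_eqF ?mul0r.
  by rewrite (eq_gt _ lt_ij) ltn_eqF ?mul0r // m_dec.
by rewrite gtn_eqF ?mul0r // (ltn_trans lt_ml) // l_dec.
Qed.

Lemma det_hmat0 l : (forall i j : 'I_N, (i < j -> l j < l i)%N) ->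
  \det (hmat 0 l) = [forall i, l i == m i]%:R.
Proof.
move=> l_dec; case: forallP => [lm | /forallP]; last first.
  by rewrite negb_forall => /existsP[i]; exact: det_hmat_eq0.
rewrite [X in \det X](_ : _ = 1%:M) ?det1 //.
apply/matrixP=> i j; rewrite !mxE hdiff_empty ?minn0 // (eqP (lm i)); congr (_ %:R).
case: (ltngtP i j) => [H|H|/val_inj ->]; last by rewrite !eqxx.
  by rewrite gtn_eqF ?m_dec // -val_eqE ltn_eqF.
by rewrite ltn_eqF ?m_dec // -val_eqE gtn_eqF.
Qed.

(** By [hdiffS] the part of an active row in the columns with a_j <= B is a combination of rows with
    labels n <= l_i. Row operations remove the labels that violate interlacing, and multilinearity
    in the rows gives the sum over strips. *)
Lemma det_hmatS B l : (forall i j : 'I_N, (i < j -> l j < l i)%N) ->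
  (forall i, l i < W)%N ->
  (forall i, (B < a i)%N -> l i = m i) ->
  \det (hmat B.+1 l) =
  \sum_(n : {ffun 'I_N -> 'I_W} | [forall i, strip B l i (n i)])
     (\prod_i x B ^+ (l i - n i)) * \det (hmat B (fun i => n i)).
Proof.
move=> l_dec l_lt l_fix.
(* Subtracting x^(l_i - l_(i+1)) times row i+1 from row i leaves, in the sum   *)
(* over k <= l_i for row i, only the terms with l_(i+1) < k.                  *)
pose U : 'M[R]_N := \matrix_(i, k) ((i == k)%:R -
  if [&& k == i.+1 :> nat, active B i & active B k] then x B ^+ (l i - l k) else 0).
have detU : \det U = 1.
  rewrite -det_tr det_trig; last first.
    apply/is_trig_mxP=> i k lt_ik; rewrite !mxE -val_eqE gtn_eqF // .
    by rewrite (_ : (_ == _.+1) = false) ?subr0 //; apply/eqP=> /= E; lia.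
  by apply: big1 => i _; rewrite !mxE eqxx (ltn_eqF (ltnSn _)) subr0.
have UM i j : (U *m hmat B.+1 l) i j =
    \sum_(k : 'I_W | strip B l i k) x B ^+ (l i - k)
       * hdiff x (a j) (minn (b i) B) k (m j).
  have lt_of_a (k k' : 'I_N) : (a k <= B < a k')%N -> (k < k')%N.
    case/andP=> le_k lt_j; rewrite ltnNge; apply/negP => /a_inc; lia.
  have -> : (U *m hmat B.+1 l) i j = hmat B.+1 l i j -
      \sum_(k : 'I_N | [&& k == i.+1 :> nat, active B i & active B k])
         x B ^+ (l i - l k) * hmat B.+1 l k j.
    rewrite mxE; under eq_bigr do rewrite mxE mulrBl.
    rewrite sumrB (bigD1 i) //= eqxx mul1r big1 ?addr0; last first.
      by move=> k ne_ki; rewrite eq_sym (negbTE ne_ki) mul0r.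
    congr (_ - _); rewrite [RHS]big_mkcond; apply: eq_bigr => k _.
    by case: ifP; rewrite ?mul0r.
  rewrite /strip; case: (boolP (active B i)) => [act_i | nact_i]; last first.
    rewrite big1 ?subr0; last by move=> k /andP[].
    rewrite (big_pred1 (Ordinal (l_lt i))) => [|k]; last by rewrite /= -val_eqE.
    rewrite mxE /= subnn expr0 mul1r.
    (* Row i is inactive for one of two reasons. If b_i <= B, both caps give b_i. If B < a_i, then
       columns with B < a_j consist of deltas, and in the other columns j < i, so m_j > m_i = l_i
       and both sides are 0. *)
    case: (leqP (b i) B) => [le_b | lt_b].
      by congr hdiff; rewrite (minn_idPl _) // leqW.
    have lt_a : (B < a i)%N by move: nact_i; rewrite /active lt_b andbT -ltnNge.
    case: (ltnP B (a j)) => [lt_aj | le_aj].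
      by rewrite !hdiff_empty //; lia.
    by rewrite !hdiff_lt // l_fix // m_dec // lt_of_a ?le_aj.
  have /andP[le_ai lt_bi] := act_i.
  (* If B < a_j, column j consists of deltas testing equality with m_j = l_j. Active rows lie above
     row j, so their labels exceed l_j, as do the labels k allowed by the strip condition:
     everything vanishes. *)
  case: (ltnP B (a j)) => [lt_aj | le_aj].
    have z (k : 'I_N) : active B k -> hmat B.+1 l k j = 0.
      case/andP=> le_ak _; rewrite mxE hdiff_empty; last by rewrite geq_min lt_aj orbT.
      by rewrite -l_fix // gtn_eqF // l_dec // lt_of_a ?le_ak.
    rewrite z // sub0r big1 ?oppr0; last by move=> k /and3P[_ _ /z ->]; rewrite mulr0.
    rewrite big1 // => k /andP[_ /forallP/(_ j)]; rewrite lt_of_a ?le_ai //= => lt_lk.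
    rewrite hdiff_empty; first by rewrite -l_fix // gtn_eqF ?mulr0.
    by rewrite geq_min (ltnW lt_aj) orbT.
  rewrite (minn_idPr (ltnW lt_bi)).
  pose G p n := x B ^+ (p - n) * hdiff x (a j) B n (m j).
  have Hrow k : (B < b k)%N -> hmat B.+1 l k j = \sum_(n < W | (n <= l k)%N) G (l k) n.
    move=> lt_bk; rewrite mxE (minn_idPr _) // hdiffS //.
    by rewrite (big_ord_widen _ (G (l k)) (l_lt k)).
  rewrite Hrow //; case: (ltnP i.+1 N) => [lt_i1 | ge_N]; last first.
    rewrite [X in _ - X]big1 ?subr0; last first.
      by move=> k /and3P[/eqP E _ _]; have := ltn_ord k; lia.
    apply: eq_bigl => k; rewrite [X in _ = _ && X](_ : _ = true) ?andbT //.
    by apply/forallP=> k'; apply/implyP; have := ltn_ord k'; lia.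
  pose i' := Ordinal lt_i1.
  have stripE (k : 'I_W) :
      [forall j : 'I_N, (i < j)%N ==> (l j < k)%N] = ~~ (k <= l i')%N.
    rewrite -ltnNge; apply/forallP/idP => [/(_ i')|lt_k k']; first by rewrite leqnn.
    apply/implyP=> lt_ik'; apply: leq_ltn_trans lt_k.
    case: (ltngtP i' k') => [/l_dec/ltnW||/val_inj -> //] //.
    by rewrite ltnNge lt_ik'.
  under [RHS]eq_bigl do rewrite stripE.
  rewrite (bigID (fun n : 'I_W => (n <= l i')%N)) /=.
  have lt_bi' : (B < b i')%N by apply: leq_trans lt_bi (b_inc _).
  have lt_l := l_dec i i' (ltnSn i).
  (* If row i + 1 is active, the subtracted multiple of it is exactly the part n <= l_(i+1) of row
     i. Otherwise nothing is subtracted, but that part is already 0: a_j <= B < a_(i+1) forces m_j >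
     m_(i+1) = l_(i+1). *)
  case: (leqP (a i') B) => [le_ai' | lt_ai'].
    rewrite [X in _ - X](big_pred1 i') => [|k]; last first.
      rewrite /= -val_eqE /=; case: eqP => //= E; rewrite (_ : k = i') ?act_i.
        by rewrite /active le_ai'.
      exact: val_inj.
    rewrite Hrow // mulr_sumr [X in X + _ - _](_ : _ = \sum_(n < W | (n <= l i')%N)
      x B ^+ (l i - l i') * G (l i') n); first by rewrite addrAC subrr add0r.
    rewrite (eq_bigl (fun n : 'I_W => (n <= l i')%N)); last by move=> n /=; lia.
    apply: eq_bigr => n le_n; rewrite /G mulrA -exprD; congr (_ ^+ _ * _); lia.
  rewrite [X in X + _ - _]big1 ?add0r; last first.
    move=> n /andP[_ le_n]; rewrite /G hdiff_lt ?mulr0 // (leq_ltn_trans le_n) //.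
    by rewrite l_fix // m_dec // lt_of_a ?le_aj.
  rewrite [X in _ - X]big1 ?subr0 // => k /andP[/eqP E /andP[]].
  by rewrite (_ : k = i') 1?leqNgt ?lt_ai' //; apply: val_inj.
rewrite -[LHS]mul1r -[X in X * _]detU -det_mulmx /determinant.
transitivity (\sum_(s : 'S_N) \sum_(n : {ffun 'I_N -> 'I_W} | [forall i, strip B l i (n i)])
   (-1) ^+ s * \prod_i (x B ^+ (l i - n i)
      * hdiff x (a (s i)) (minn (b i) B) (n i) (m (s i)))).
  apply: eq_bigr => s _; under [X in _ * X]eq_bigr do rewrite UM.
  rewrite bigA_distr_big_dep mulr_sumr; apply: eq_bigl => n.
  by apply/familyP/forallP => H i; apply: (H i).
rewrite exchange_big; apply: eq_bigr => n _; rewrite mulr_sumr; apply: eq_bigr => s _.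
rewrite big_split /= mulrCA; congr (_ * (_ * _)).
by apply: eq_bigr => i _; rewrite mxE.
Qed.

End DetRecursion.

(** * Tableaux on a rectangle *)

Lemma ltn_dec_diff N (l : 'I_N -> nat) (i j : 'I_N) :
  (forall i j : 'I_N, (i < j -> l j < l i)%N) -> (i <= j)%N ->
  (l j + (j - i) <= l i)%N.
Proof.
move=> l_dec; have [k le_k] := ubnP (j - i); elim: k i le_k => // k IH i lt_k le_ij.
case: (ltngtP i j) le_ij => // [lt_ij | /val_inj -> ] _; last by rewrite subnn addn0.
have lt_i1 : (i.+1 < N)%N by apply: leq_ltn_trans (ltn_ord j).
have := IH (Ordinal lt_i1); have := l_dec i (Ordinal lt_i1) (ltnSn i) => /=; lia.
Qed.

Lemma card_initial W (P : pred 'I_W.+1) (k : nat) :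
  (forall c : 'I_W.+1, P c = (c < k)%N) -> (k <= W.+1)%N -> #|P| = k.
Proof.
move=> Pk le_k; rewrite -sum1_card (eq_bigl (fun c : 'I_W.+1 => (c < k)%N)) //.
by rewrite -(big_ord_widen W.+1 (fun=> 1%N) le_k) sum_nat_const card_ord muln1.
Qed.

(** Used for the set of positions in a weakly increasing row whose entry is at most B: its
    cardinality determines it. *)
Lemma antitone_initial W (P : pred 'I_W.+1) (c : 'I_W.+1) :
  (forall c c' : 'I_W.+1, (c < c')%N -> P c' -> P c) -> P c = (c < #|P|)%N.
Proof.
move=> antiP.
have [k le_k Pk] : exists2 k, (k <= W.+1)%N & forall c : 'I_W.+1, P c = (c < k)%N.
  pose Q k := [forall c : 'I_W.+1, P c ==> (c < k)%N].
  have exQ : exists k, Q k by exists W.+1; apply/forallP=> d; rewrite ltn_ord implybT.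
  case: (ex_minnP exQ) => k /forallP Qk min_k; exists k.
    by apply: min_k; apply/forallP=> d; rewrite ltn_ord implybT.
  move=> d; apply/idP/idP => [Pd | lt_dk]; first exact: (implyP (Qk d)).
  apply: contraLR lt_dk => nPd; rewrite -leqNgt min_k //; apply/forallP=> e.
  apply/implyP=> Pe; rewrite ltnNge leq_eqVlt negb_or; apply/andP; split.
    by apply: contraNneq nPd => /val_inj ->.
  by apply: contra nPd => /antiP; apply.
by rewrite (card_initial Pk le_k).
Qed.

Section RectangularTableaux.
Variables (R : comNzRingType) (x : nat -> R) (N W V : nat).
Variables (m a b : 'I_N -> nat).
Hypothesis m_dec : forall i j : 'I_N, (i < j -> m j < m i)%N.
Hypothesis a_inc : forall i j : 'I_N, (i <= j -> a i <= a j)%N.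
Hypothesis b_inc : forall i j : 'I_N, (i <= j -> b i <= b j)%N.

Notation rect := {ffun 'I_N * 'I_W.+1 -> 'I_V.+1}.

(* In the shifted coordinates c = j + (N - i - 1) row i of the skew shape       *)
(* consists of the c with m i <= c < l i, and two boxes are in the same column *)
(* when c + i agrees. Entries left of the shape are 0, those to its right V.   *)
Definition ent (T : rect) (i : 'I_N) (c : 'I_W.+1) : nat := T (i, c).

(** Rows increase weakly across the padding too, so that small entries form an initial segment.
    Columns are strict only between boxes, since padding repeats values. *)
Record rtab_spec (B : nat) (l : 'I_N -> nat) (T : rect) : Prop := RtabSpec {
  rtab_incl : forall i, (m i <= l i)%N;
  rtab_left : forall i (c : 'I_W.+1), (c < m i)%N -> ent T i c = 0%N;
  rtab_right : forall i (c : 'I_W.+1), (l i <= c)%N -> ent T i c = V;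
  rtab_flag : forall i (c : 'I_W.+1), (m i <= c < l i)%N -> (a i < ent T i c <= minn (b i) B)%N;
  rtab_row : forall i (c c' : 'I_W.+1), (c < c')%N -> (ent T i c <= ent T i c')%N;
  rtab_col : forall (i i' : 'I_N) (c c' : 'I_W.+1), (i < i')%N -> (c + i = c' + i')%N ->
    (m i <= c < l i)%N -> (m i' <= c' < l i')%N -> (ent T i c < ent T i' c')%N }.

Definition rtab (B : nat) (l : 'I_N -> nat) (T : rect) : bool :=
  [&& [forall i, m i <= l i]%N,
      [forall i, forall c : 'I_W.+1, (c < m i) ==> (ent T i c == 0)]%N,
      [forall i, forall c : 'I_W.+1, (l i <= c) ==> (ent T i c == V)]%N,
      [forall i, forall c : 'I_W.+1, (m i <= c < l i) ==> (a i < ent T i c <= minn (b i) B)]%N,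
      [forall i, forall c : 'I_W.+1, forall c' : 'I_W.+1,
         (c < c') ==> (ent T i c <= ent T i c')]%N
    & [forall i : 'I_N, forall i' : 'I_N, forall c : 'I_W.+1, forall c' : 'I_W.+1,
         [&& i < i', c + i == c' + i', m i <= c < l i & m i' <= c' < l i'] ==>
         (ent T i c < ent T i' c')]%N].

Lemma rtabP B l T : reflect (rtab_spec B l T) (rtab B l T).
Proof.
apply: (iffP idP) => [/and5P[/forallP h1 /'forall_forallP h2 /'forall_forallP h3
    /'forall_forallP h4 /andP[/'forall_'forall_forallP h5 /'forall_'forall_'forall_forallP h6]]
   | [h1 h2 h3 h4 h5 h6]].
  split=> //; do ?[by move=> i c; apply/implyP].
  - by move=> i c lt_c; apply/eqP; apply: (implyP (h2 i c)).
  - by move=> i c lt_c; apply/eqP; apply: (implyP (h3 i c)).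
  - by move=> i c c'; apply/implyP.
  by move=> i i' c c' lt_i /eqP E b1 b2; apply: (implyP (h6 i i' c c')); apply/and4P.
apply/and5P; split; last (apply/andP; split).
- exact/forallP.
- by apply/'forall_forallP=> i c; apply/implyP=> /h2 ->.
- by apply/'forall_forallP=> i c; apply/implyP=> /h3 ->.
- by apply/'forall_forallP=> i c; apply/implyP=> /h4.
- by apply/'forall_'forall_forallP=> i c c'; apply/implyP=> /h5.
apply/'forall_'forall_'forall_forallP=> i i' c c'.
by apply/implyP=> /and4P[lt_i /eqP E b1 b2]; apply: h6.
Qed.

Definition rwt (l : 'I_N -> nat) (T : rect) : R :=
  \prod_(u : 'I_N * 'I_W.+1 | (m u.1 <= u.2 < l u.1)%N) x (T u).-1.

Lemma rtab_sum0 l : (0 < V)%N -> (forall i, l i <= W)%N ->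
  \sum_(T | rtab 0 l T) rwt l T = [forall i, l i == m i]%:R.
Proof.
move=> V_gt0 l_le; case: forallP => [lm | nlm]; last first.
  rewrite big1 // => T /rtabP[h1 _ _ h4 _ _]; case: nlm => i.
  apply/negPn/negP => ne; have lt_ml : (m i < l i)%N by rewrite ltn_neqAle eq_sym ne h1.
  have lt_mW : (m i < W.+1)%N by rewrite (leq_trans lt_ml) // leqW.
  by have := h4 i (Ordinal lt_mW); rewrite /= leqnn lt_ml minn0 => /(_ isT); lia.
have {}lm i : l i = m i by apply/eqP.
pose T0 : rect := [ffun u : 'I_N * 'I_W.+1 => if (u.2 < m u.1)%N then ord0 else ord_max].
rewrite (big_pred1 T0) => [|T]; first by rewrite /rwt big1 // => u; rewrite lm; lia.
apply/rtabP/eqP => [[_ h2 h3 _ _ _] | ->].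
  apply/ffunP=> -[i c]; apply: val_inj; rewrite ffunE /=.
  by case: ltnP => [/h2 // | ?]; apply: h3; rewrite lm.
split=> [i|i c|i c|i c|i c c' lt_c|i i' c c' _ _]; rewrite ?lm /ent ?ffunE //=; try lia.
- by move=> ->.
- by rewrite ltnNge => ->.
- by case: ltnP => //; case: ltnP => //=; lia.
Qed.

Definition rstrip (B : nat) (l : 'I_N -> nat) (n : {ffun 'I_N -> 'I_W.+1}) : bool :=
  [forall i, strip a b B l i (n i)].

(** The zeros to the left of the shape are counted as well, so the count is directly the label n_i
    of the subshape holding the entries at most B. *)
Definition below (B : nat) (T : rect) : {ffun 'I_N -> 'I_W.+1} :=
  [ffun i => inord #|[pred c : 'I_W.+1 | (ent T i c <= B)%N]|].

(** Boxes with entry B + 1 lie to the right of the smaller shape and receive its right padding,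
    [ord_max], that is, V. *)
Definition truncate (B : nat) (T : rect) : rect :=
  [ffun u : 'I_N * 'I_W.+1 => if T u == B.+1 :> nat then ord_max else T u].

Definition extend (B : nat) (l : 'I_N -> nat) (n : {ffun 'I_N -> 'I_W.+1}) (T : rect) : rect :=
  [ffun u : 'I_N * 'I_W.+1 => if (n u.1 <= u.2 < l u.1)%N then inord B.+1 else T u].

Lemma ent_truncate B T i c :
  ent (truncate B T) i c = if ent T i c == B.+1 then V else ent T i c.
Proof. by rewrite /ent ffunE; case: ifP. Qed.

(** * Removing and restoring the boxes with the largest entry *)

Section Step.
Variables (B : nat) (l : 'I_N -> nat).
Hypothesis lt_BV : (B.+1 < V)%N.
Hypothesis l_dec : forall i j : 'I_N, (i < j -> l j < l i)%N.
Hypothesis l_le : forall i, (l i <= W)%N.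

Lemma belowE T i c : rtab B.+1 l T -> (ent T i c <= B)%N = (c < below B T i)%N.
Proof.
case/rtabP=> h1 h2 h3 h4 h5 h6.
have E d : (ent T i d <= B)%N = (d < #|[pred c : 'I_W.+1 | (ent T i c <= B)%N]|)%N.
  apply: (@antitone_initial W [pred c : 'I_W.+1 | (ent T i c <= B)%N]).
  by move=> e e' lt_e /=; apply: leq_trans; apply: h5.
(* [inord] is faithful because the count is at most W: the last position W is right padding, as l_i
   <= W, and V exceeds B. *)
rewrite E ffunE inordK // ltnS leqNgt; apply/negP => lt_W.
have := E ord_max; rewrite /= lt_W h3 //=; lia.
Qed.

Lemma rstrip_below T : rtab B.+1 l T -> rstrip B l (below B T).
Proof.
move=> rT; have bE i c := belowE i c rT; have [h1 h2 h3 h4 h5 h6] := rtabP _ _ _ rT.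
suff st (i : 'I_N) : strip a b B l i (below B T i) by apply/forallP.
rewrite /strip; case: ifP => [/andP[le_a lt_b] | nact].
  apply/andP; split.
    have := bE i (inord (l i)); rewrite h3 inordK ?ltnS //; lia.
  suff st (j : 'I_N) : (i < j)%N -> (l j < below B T i)%N.
    by apply/forallP=> j; apply/implyP/st.
  move=> lt_ij; have lt_l := l_dec lt_ij.
  have := bE i (inord (l j)); rewrite inordK ?ltnS // => <-.
  case: (ltnP (l j) (m i)) => [lt_lm | le_ml].
    by rewrite h2 // inordK ?ltnS.
  (* In row j, the position in the same column as (i, l_j) is l_j + i - j, and it is a box because m
     drops by at least j - i between rows i and j. Its entry is at most B + 1, so column strictness
     makes the entry at (i, l_j) at most B. *)
  have := ltn_dec_diff m_dec (ltnW lt_ij) => dm.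
  rewrite -ltnS; have bj : (m j <= l j + i - j < l j)%N by lia.
  have c'E : (inord (l j + i - j) : 'I_W.+1) = (l j + i - j)%N :> nat.
    by rewrite /= inordK // ltnS; have := l_le j; lia.
  apply: (@leq_trans (ent T j (inord (l j + i - j)))).
    apply: h6; rewrite //= ?c'E ?inordK ?ltnS ?le_ml //; lia.
  have := h4 j (inord (l j + i - j)); rewrite c'E bj => /(_ isT) /andP[_ /leq_trans]; apply; exact: geq_minr.
suff E c : (ent T i c <= B)%N = (c < l i)%N.
  apply/eqP; case: (ltngtP (below B T i) (l i)) => // [lt_bl | lt_lb].
    have := bE i (below B T i); rewrite E lt_bl ltnn //.
  have := E (inord (l i)); rewrite bE inordK ?ltnS // lt_lb ltnn //.
case: (ltnP c (m i)) => [lt_cm | le_mc]; first by rewrite h2 // (leq_trans lt_cm).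
case: (ltnP c (l i)) => [lt_cl | le_lc]; last by rewrite h3 //; lia.
have := h4 i c; rewrite le_mc lt_cl => /(_ isT).
by move: nact; rewrite /active; lia.
Qed.

Lemma rtab_truncate T : rtab B.+1 l T -> rtab B (fun i => below B T i) (truncate B T).
Proof.
move=> rT; have bE i c := belowE i c rT; have [h1 h2 h3 h4 h5 h6] := rtabP _ _ _ rT.
have sT i := forallP (rstrip_below rT) i.
have le_bl i : (below B T i <= l i)%N.
  by have := sT i; rewrite /strip; case: ifP => [_ /andP[]//|_ /eqP ->].
have le_mb i : (m i <= below B T i)%N.
  rewrite leqNgt; apply/negP => lt_bm; have := bE i (below B T i).
  by rewrite ltnn h2.
apply/rtabP; split=> //.
- by move=> i c lt_c; rewrite ent_truncate h2.
- move=> i c le_bc; rewrite ent_truncate.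
  have := bE i c; rewrite ltnNge le_bc /= => /negbT; rewrite -ltnNge => lt_B.
  case: eqP => //= ne; apply: h3; rewrite leqNgt; apply/negP=> lt_cl.
  have := h4 i c; rewrite lt_cl (leq_trans (le_mb i) le_bc) => /(_ isT); lia.
- move=> i c /andP[le_mc lt_cb]; rewrite ent_truncate; have := bE i c; rewrite lt_cb => le_B.
  rewrite ltn_eqF ?ltnS //; have := h4 i c; rewrite le_mc (leq_trans lt_cb) // => /(_ isT); lia.
- move=> i c c' lt_c; rewrite !ent_truncate; have le_T := h5 i c c' lt_c.
  case: eqP => [E | _]; last first.
    by case: eqP => //= _; rewrite -ltnS ltn_ord.
  case: eqP => //= ne'; rewrite h3 // leqNgt; apply/negP=> lt_cl.
  have := h4 i c'; have := h2 i c'; lia.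
- move=> i i' c c' lt_i Ec /andP[b1 b2] /andP[b3 b4]; rewrite !ent_truncate.
  rewrite !ltn_eqF ?ltnS ?bE //; apply: h6; rewrite // ?b1 ?b3 /=.
    exact: leq_trans (le_bl _).
  exact: leq_trans (le_bl _).
Qed.

Lemma ent_extend (n : {ffun 'I_N -> 'I_W.+1}) T i c :
  ent (extend B l n T) i c = if (n i <= c < l i)%N then B.+1 else ent T i c.
Proof. by rewrite /ent ffunE /=; case: ifP => //; rewrite inordK // leqW // ltnW. Qed.

Lemma strip_le (n : {ffun 'I_N -> 'I_W.+1}) (i : 'I_N) : rstrip B l n -> (n i <= l i)%N.
Proof. by move/forallP/(_ i); rewrite /strip; case: ifP => [_ /andP[]//|_ /eqP ->]. Qed.

Lemma strip_active (n : {ffun 'I_N -> 'I_W.+1}) (i : 'I_N) : rstrip B l n ->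
  (n i < l i)%N -> active a b B i.
Proof.
by move/forallP/(_ i); rewrite /strip; case: ifP => // _ /eqP ->; rewrite ltnn.
Qed.

(** The removed boxes form a horizontal strip: a box with another one below it in its column has c
    <= l_(i+1), since l is strictly decreasing, and the strip condition gives l_(i+1) < n_i in an
    active row. *)
Lemma strip_col (n : {ffun 'I_N -> 'I_W.+1}) (i i' : 'I_N) (c c' : nat) : rstrip B l n ->
  (i < i')%N -> (c + i = c' + i')%N -> (c < l i)%N -> (c' < l i')%N -> (c < n i)%N.
Proof.
move=> sn lt_i Ec lt_c lt_c'; have lt_i1 : (i.+1 < N)%N by apply: leq_ltn_trans (ltn_ord i').
have /forallP/(_ i) := sn; rewrite /strip; case: ifP => [_ | _ /eqP ->] //.
case/andP=> _ /forallP/(_ (Ordinal lt_i1)); rewrite /= leqnn /=.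
have := @ltn_dec_diff _ l (Ordinal lt_i1) i' l_dec lt_i; rewrite /=; lia.
Qed.

Lemma ent_le_top T i c : (ent T i c <= V)%N.
Proof. by rewrite -ltnS ltn_ord. Qed.

Lemma rtab_extend n T : rstrip B l n -> rtab B (fun i => n i) T -> rtab B.+1 l (extend B l n T).
Proof.
move=> sn /rtabP[h1 h2 h3 h4 h5 h6].
have le_nl i := strip_le i sn.
have leB i (c : 'I_W.+1) : (c < n i)%N -> (ent T i c <= B)%N.
  move=> lt_c; case: (ltnP c (m i)) => [/h2 -> // | le_c].
  by have := h4 i c; rewrite le_c lt_c => /(_ isT); lia.
apply/rtabP; split.
- by move=> i; apply: leq_trans (le_nl i).
- by move=> i c lt_c; rewrite ent_extend h2 //; have := h1 i; case: ifP => //; lia.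
- by move=> i c le_c; rewrite ent_extend ltnNge le_c andbF h3 // (leq_trans (le_nl i)).
- move=> i c /andP[le_c lt_c]; rewrite ent_extend lt_c andbT.
  case: (leqP (n i) c) => [le_nc | lt_cn].
    have := strip_active sn (leq_ltn_trans le_nc lt_c); rewrite /active; lia.
  by have := h4 i c; rewrite le_c lt_cn => /(_ isT); lia.
- move=> i c c' lt_c; rewrite !ent_extend; have := h5 i c c' lt_c.
  have := le_nl i; have := leB i c; have := h3 i c'; have := leB i c'.
  by case: ifP; case: ifP => //; lia.
move=> i i' c c' lt_i Ec /andP[b1 b2] /andP[b3 b4]; rewrite !ent_extend.
have lt_c := strip_col sn lt_i Ec b2 b4.
rewrite [(n i <= c)%N]leqNgt lt_c /= b4 andbT; case: (leqP (n i') c') => [_ | lt_c']; first by rewrite ltnS leB.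
by apply: h6; rewrite ?b1 ?b3.
Qed.

Lemma below_extend n T : rstrip B l n -> rtab B (fun i => n i) T ->
  below B (extend B l n T) = n.
Proof.
move=> sn rT; have := rtab_extend sn rT; move/rtabP: rT => [h1 h2 h3 h4 h5 h6] rE.
apply/ffunP=> i; rewrite ffunE; apply/val_inj.
rewrite (@card_initial _ _ (n i)) ?inord_val // => [c|]; last exact: ltnW.
rewrite /= -[X in (X <= B)%N]/(ent (extend B l n T) i c) ent_extend.
have := h2 i c; have := h4 i c; have := h3 i c; have := strip_le i sn.
by case: ifP; case: (ltnP c (m i)); lia.
Qed.

Lemma ent_inj T T' : (forall i c, ent T i c = ent T' i c) -> T = T'.
Proof. by move=> E; apply/ffunP=> -[i c]; apply/val_inj/E. Qed.

Lemma truncateK T : rtab B.+1 l T -> extend B l (below B T) (truncate B T) = T.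
Proof.
move=> rT; have bE i c := belowE i c rT; have [h1 h2 h3 h4 h5 h6] := rtabP _ _ _ rT.
apply: ent_inj => i c; rewrite ent_extend ent_truncate.
have := bE i c; have := h2 i c; have := h3 i c; have := h4 i c.
by case: (ent T i c =P B.+1) => ?; case: ifP; lia.
Qed.

Lemma extendK n T : rstrip B l n -> rtab B (fun i => n i) T ->
  truncate B (extend B l n T) = T.
Proof.
move=> sn /rtabP[h1 h2 h3 h4 h5 h6]; apply: ent_inj => i c.
rewrite ent_truncate ent_extend.
have := h2 i c; have := h3 i c; have := h4 i c.
by case: (boolP (n i <= c < l i)%N); [rewrite eqxx | case: (ent T i c =P B.+1)]; lia.
Qed.

Lemma rwt_extend n T : rstrip B l n -> rtab B (fun i => n i) T ->
  rwt l (extend B l n T) = \prod_i x B ^+ (l i - n i) * rwt (fun i => n i) T.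
Proof.
move=> sn /rtabP[h1 h2 h3 h4 h5 h6].
rewrite /rwt (bigID (fun u : 'I_N * 'I_W.+1 => (n u.1 <= u.2)%N)) /=; congr (_ * _).
  transitivity (\prod_i \prod_(c : 'I_W.+1 | (n i <= c < l i)%N) x (extend B l n T (i, c)).-1).
    rewrite pair_big_dep /=; apply: eq_big => [[i c]|[i c]] //=.
    by have := h1 i; lia.
  apply: eq_bigr => i _; rewrite (eq_bigr (fun=> x B)); last first.
    by move=> c Pc; have := ent_extend n T i c; rewrite Pc /ent => ->.
  rewrite prodr_const; congr (_ ^+ _).
  rewrite -sum1_card; have le_nl := strip_le i sn.
  transitivity (\sum_(n i <= c < l i) 1)%N; last by rewrite sum_nat_const_nat muln1.
  rewrite big_geq_mkord (big_ord_widen_cond W.+1 (fun c => n i <= c)%N (fun=> 1%N)) ?leqW //.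
apply: eq_big => [u | u Pu]; first by have := strip_le u.1 sn; lia.
have := ent_extend n T u.1 u.2; rewrite /ent -surjective_pairing => ->.
by case: ifP => //; lia.
Qed.

(** Tableaux are grouped by the shape of their entries at most B; on each group [truncate] and
    [extend] are mutually inverse, and the removed boxes contribute the powers of [x B]. *)
Lemma rtab_sumS :
  \sum_(T | rtab B.+1 l T) rwt l T =
  \sum_(n | rstrip B l n)
    (\prod_i x B ^+ (l i - n i)) * \sum_(T | rtab B (fun i => n i) T) rwt (fun i => n i) T.
Proof.
rewrite (partition_big (below B) (rstrip B l)) /=; last exact: rstrip_below.
apply: eq_bigr => n sn; rewrite mulr_sumr.
rewrite (reindex_onto (extend B l n) (truncate B)); last first.
  by move=> T /andP[rT /eqP <-]; rewrite truncateK.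
rewrite (eq_bigl (rtab B (fun i => n i))); last first.
  move=> T; apply/idP/idP => [/andP[/andP[rT /eqP En] /eqP <-] | rT].
    by have := rtab_truncate rT; rewrite En.
  by rewrite rtab_extend // below_extend // extendK // !eqxx.
by apply: eq_bigr => T rT; rewrite rwt_extend.
Qed.

End Step.

Theorem rect_jacobi_trudi B l : (B < V)%N ->
  (forall i j : 'I_N, (i < j -> l j < l i)%N) -> (forall i, l i <= W)%N ->
  \sum_(T | rtab B l T) rwt l T = \det (hmat x m a b B l).
Proof.
elim: B l => [|B IH] l lt_BV l_dec l_le.
  by rewrite rtab_sum0 // det_hmat0.
(* A row with B < a_i admits no entry up to B + 1. If its labels differ, no tableau exists and the
   determinant vanishes too; excluding this case provides the hypothesis on such rows in
   [det_hmatS]. *)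
case: (boolP [exists i, (B < a i)%N && (l i != m i)]) => [/existsP[i /andP[lt_a ne]] | ].
  rewrite (det_hmat_eq0 x b m_dec a_inc l_dec lt_a ne) big1 // => T /rtabP[h1 _ _ h4 _ _].
  have lt_ml : (m i < l i)%N by rewrite ltn_neqAle eq_sym ne h1.
  have lt_mW : (m i < W.+1)%N by rewrite (leq_trans lt_ml) // leqW.
  by have := h4 i (Ordinal lt_mW); rewrite /= leqnn lt_ml => /(_ isT); lia.
rewrite negb_exists => /forallP l_fix.
rewrite rtab_sumS // (@det_hmatS _ x N W.+1 m a b) //; last first.
  by move=> i lt_a; apply/eqP; have := l_fix i; rewrite lt_a negbK.
apply: eq_bigr => n sn; congr (_ * _); apply: IH => [|i j lt_ij|i]; first exact: ltnW.
  apply: (leq_ltn_trans (strip_le j sn)).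
  have /forallP/(_ i) := sn; rewrite /strip; case: ifP => [_|_ /eqP ->]; last exact: l_dec.
  by case/andP=> _ /forallP/(_ j)/implyP; apply.
by rewrite -ltnS.
Qed.

End RectangularTableaux.

(** * The flagged Jacobi-Trudi formula *)

Lemma nth_gt0_num_parts la i : is_partition la -> (0 < nth 0 la i)%N -> (i < num_parts la)%N.
Proof.
move=> la_part pos_i; have lt_i : (i < size la)%N.
  by rewrite ltnNge; apply: contraL pos_i => le_i; rewrite nth_default.
rewrite /num_parts -(cat_take_drop i.+1 la) count_cat.
apply: leq_trans (leq_addr _ _); suff /eqP -> : count (leq 1) (take i.+1 la) == i.+1 by [].
have sz : size (take i.+1 la) = i.+1 by rewrite size_takel.
rewrite -[X in _ == X]sz -all_count; apply/(all_nthP 0%N) => j; rewrite sz ltnS => le_j.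
by rewrite nth_take //; apply: leq_trans pos_i (nth_partition la_part le_j).
Qed.

Lemma nth_flag a i j : is_flag a -> (i <= j < size a)%N -> (nth 0 a i <= nth 0 a j)%N.
Proof.
move=> a_inc /andP[le_ij lt_j]; apply: (sorted_leq_nth leq_trans leqnn 0 a_inc) => //.
by rewrite inE (leq_ltn_trans le_ij).
Qed.

Lemma nth_le_max (s : seq nat) i : (nth 0 s i <= \max_(x <- s) x)%N.
Proof.
case: (ltnP i (size s)) => [lt_i | le_i]; last by rewrite nth_default.
by apply: (leq_bigmax_seq (F := fun y => y) (P := xpredT)) => //; apply: mem_nth.
Qed.

Section FlaggedDeterminant.
Variables (C : comNzRingType) (N : nat) (la mu a b : seq nat).
Hypothesis la_part : is_partition la.
Hypothesis mu_part : is_partition mu.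
Hypothesis la_le : (num_parts la <= N)%N.
Hypothesis mu_le : (num_parts mu <= N)%N.
Hypothesis a_flag : is_flag a.
Hypothesis b_flag : is_flag b.
Hypothesis a_size : size a = N.
Hypothesis b_size : size b = N.

(** K bounds every entry, leaving K + 1 as the right padding. *)
Let K := \max_(x <- b) x.
Let W := (\max_(l <- la) l + N)%N.
Let l (i : 'I_N) := nth 0%N (beta N la) i.
Let m (i : 'I_N) := nth 0%N (beta N mu) i.
Let fa (i : 'I_N) := nth 0%N a i.
Let fb (i : 'I_N) := nth 0%N b i.
Local Notation rect := {ffun 'I_N * 'I_W.+1 -> 'I_K.+2}.
Local Notation rtab := (@rtab N W K.+1 m fa fb K l).

Let lE i : l i = (nth 0 la i + (N - i.+1))%N.
Proof. by rewrite /l nth_mkseq. Qed.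

Let mE i : m i = (nth 0 mu i + (N - i.+1))%N.
Proof. by rewrite /m nth_mkseq. Qed.

Let brow_lt (u : skew_box la mu) : (brow u < N)%N.
Proof.
apply: leq_trans la_le; apply: nth_gt0_num_parts => //.
by case/andP: (valP u) => _; apply: leq_ltn_trans.
Qed.

Let col_le (u : skew_box la mu) : (bcol u + (N - (brow u).+1) < W.+1)%N.
Proof. by rewrite /W ltnS leq_add ?leq_subr //; exact: ltnW (ltn_ord (val u).2). Qed.

Let pos (u : skew_box la mu) : 'I_N * 'I_W.+1 := (Ordinal (brow_lt u), Ordinal (col_le u)).

Let pos_inj : injective pos.
Proof.
move=> u v [Er Ec]; apply: val_inj; have Er' : brow u = brow v by [].
have Ec' : bcol u = bcol v by move: Ec; rewrite Er' => /addIn.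
rewrite [val u]surjective_pairing [val v]surjective_pairing.
by congr (_, _); apply: val_inj.
Qed.

Let pos_box u : (m (pos u).1 <= (pos u).2 < l (pos u).1)%N.
Proof.
have := valP u; rewrite mE lE /= -/(brow u) -/(bcol u).
by rewrite leq_add2r ltn_add2r.
Qed.

Let box_pos (i : 'I_N) (c : 'I_W.+1) : (m i <= c < l i)%N -> exists u, pos u = (i, c).
Proof.
rewrite mE lE => /andP[le_c lt_c].
have lt_i : (i < size la)%N.
  by rewrite ltnNge; apply/negP => le_i; move: lt_c; rewrite nth_default //; lia.
have lt_j : (c - (N - i.+1) < \max_(l <- la) l)%N.
  by apply: leq_trans (nth_le_max la i); lia.
have bP : (nth 0 mu (Ordinal lt_i) <= Ordinal lt_j < nth 0 la (Ordinal lt_i))%N by rewrite /=; lia.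
pose u : skew_box la mu := Sub (Ordinal lt_i, Ordinal lt_j) bP.
exists u; congr (_, _); apply: val_inj => //=.
by rewrite /bcol /brow SubK /=; lia.
Qed.

Let toR (T : filling la mu b) : rect :=
  [ffun y : 'I_N * 'I_W.+1 => if [pick u | pos u == y] is Some u then inord (T u)
           else if (y.2 < m y.1)%N then ord0 else ord_max].

Let fromR (T : rect) : filling la mu b := [ffun u => inord (T (pos u))].

Let toR_pos T u i c : pos u = (i, c) -> ent (toR T) i c = T u.
Proof.
move=> Eu; rewrite /ent ffunE; case: pickP => [v|/(_ u)]; last by rewrite Eu eqxx.
rewrite -Eu => /eqP/pos_inj ->; rewrite inordK // (leq_trans (ltn_ord _)) //.
Qed.

Let toR_out T (i : 'I_N) (c : 'I_W.+1) : ~~ (m i <= c < l i)%N ->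
  ent (toR T) i c = if (c < m i)%N then 0%N else K.+1.
Proof.
move=> out; rewrite /ent ffunE; case: pickP => [u /eqP Eu|_]; last by case: ifP.
by have := pos_box u; rewrite Eu (negbTE out).
Qed.

Let toRK : cancel toR fromR.
Proof.
move=> T; apply/ffunP=> u; rewrite ffunE; apply: val_inj.
by rewrite -[X in inord X]/(ent (toR T) (pos u).1 (pos u).2) (@toR_pos T u) // inord_val.
Qed.

Let fromRK T : (forall i, (m i <= l i)%N) -> rtab T -> toR (fromR T) = T.
Proof.
move=> le_ml /rtabP[h1 h2 h3 h4 h5 h6]; apply: ent_inj => i c.
case: (boolP (m i <= c < l i)%N) => [bx | out].
  have [u Eu] := box_pos bx; rewrite (toR_pos _ Eu) ffunE Eu inordK //.
  by have := h4 i c bx; rewrite /ent ltnS; lia.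
rewrite toR_out //; case: ltnP => [/h2 // | le_m].
by rewrite h3 //; move: out; rewrite le_m /= -leqNgt.
Qed.

Let toR_rtab T : (forall i, (m i <= l i)%N) -> rtab (toR T) = (T \in Tab la mu a b).
Proof.
move=> le_ml; rewrite inE; apply/rtabP/and3P => [[h1 h2 h3 h4 h5 h6] | [F1 F2 F3]].
  split.
  - apply/forallP=> u; have := h4 _ _ (pos_box u).
    rewrite (@toR_pos T u) //= leq_min /fa /fb /=; lia.
  - apply/'forall_forallP=> u v; apply/implyP=> /andP[/eqP Er lt_c].
    have := h5 (pos u).1 (pos u).2 (pos v).2; rewrite (@toR_pos T u) // (@toR_pos T v) //.
      by apply; rewrite /= Er ltn_add2r.
    by congr (_, _); apply: val_inj.
  apply/'forall_forallP=> u v; apply/implyP=> /andP[/eqP Ec lt_r].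
  have := h6 (pos u).1 (pos v).1 (pos u).2 (pos v).2.
  rewrite (@toR_pos T u) // (@toR_pos T v) //; apply => //; try exact: pos_box.
  by have := brow_lt u; have := brow_lt v; rewrite /= Ec; lia.
have out0 i (c : 'I_W.+1) : (c < m i)%N -> ent (toR T) i c = 0%N.
  by move=> lt_c; rewrite toR_out ?lt_c // leqNgt lt_c.
have outV i (c : 'I_W.+1) : (l i <= c)%N -> ent (toR T) i c = K.+1.
  move=> le_c; rewrite toR_out; last by rewrite [X in _ && X]ltnNge le_c andbF.
  by rewrite ltnNge (leq_trans (le_ml i) le_c).
split=> //.
- move=> i c bx; have [u Eu] := box_pos bx; rewrite (toR_pos _ Eu).
  have Ei : brow u = i by have := congr1 (fun y => val y.1) Eu.
  have /forallP/(_ u) := F1; rewrite Ei leq_min => /andP[-> ->].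
  by rewrite -ltnS ltn_ord.
- move=> i c c' lt_c.
  case: (ltnP c (m i)) => [/out0 -> // | le_mc].
  case: (ltnP c' (l i)) => [lt_cl | /outV -> ]; last exact: ent_le_top.
  have bx : (m i <= c < l i)%N by rewrite le_mc (ltn_trans lt_c).
  have bx' : (m i <= c' < l i)%N by rewrite lt_cl (leq_trans le_mc) // ltnW.
  have [u Eu] := box_pos bx; have [v Ev] := box_pos bx'.
  rewrite (toR_pos _ Eu) (toR_pos _ Ev).
  have /'forall_forallP/(_ u v)/implyP := F2; apply.
  move: lt_c Eu Ev => /[swap] -[<- <-] /[swap] -[E <-]; rewrite /= E eqxx /=.
  by rewrite ltn_add2r.
move=> i i' c c' lt_i Ec bx bx'; have [u Eu] := box_pos bx; have [v Ev] := box_pos bx'.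
rewrite (toR_pos _ Eu) (toR_pos _ Ev).
have /'forall_forallP/(_ u v)/implyP := F3; apply.
case: Eu Ev => Ei Ej [Ei' Ej']; move: lt_i Ec; rewrite -Ei -Ej -Ei' -Ej' /= => lt_i Ec.
rewrite lt_i andbT; apply/eqP; have := brow_lt u; have := brow_lt v; lia.
Qed.

Let rwt_toR T : rwt (pvar C) m l (toR T) = \prod_(u : skew_box la mu) pvar C (T u).-1.
Proof.
rewrite /rwt (eq_bigl (fun y => y \in [set pos u | u : skew_box la mu])); last first.
  move=> [i c]; apply/idP/imsetP => [/box_pos[u <-] | [u _ ->]]; last exact: pos_box.
  by exists u.
rewrite big_imset /=; last by move=> u v _ _; apply: pos_inj.
apply: eq_big => [u | u _]; first by rewrite inE.
exact: (congr1 (fun k => pvar C k.-1) (@toR_pos T u _ _ (erefl _))).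
Qed.

(** Tableaux correspond to padded rectangular ones with bound K, where the cap on b is vacuous. The
    case of mu not contained in la, with both sides 0, is covered because the t-quotients of nested
    partitions need not be nested. *)
Theorem flagged_schur_det :
  flagged_schur C la mu a b =
  \det (\matrix_(i < N, j < N) hdiff (pvar C) (nth 0 a j) (nth 0 b i)
    (nth 0 (beta N la) i) (nth 0 (beta N mu) j)).
Proof.
have dec nu : is_partition nu ->
    forall i j : 'I_N, (i < j)%N -> (nth 0%N (beta N nu) j < nth 0%N (beta N nu) i)%N.
  by move=> nu_part i j lt_ij; apply: (@beta_decr 1 N nu isT nu_part); rewrite lt_ij ltn_ord.
have inc s : is_flag s -> size s = N ->
    forall i j : 'I_N, (i <= j)%N -> (nth 0%N s i <= nth 0%N s j)%N.
  by move=> s_flag sz i j le_ij; apply: nth_flag => //; rewrite le_ij sz /=.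
have l_le i : (l i <= W)%N.
  by rewrite lE /W leq_add ?leq_subr //; apply: nth_le_max.
have JT := @rect_jacobi_trudi _ (pvar C) N W K.+1 m fa fb (dec mu mu_part)
  (inc a a_flag a_size) (inc b b_flag b_size) K l (ltnSn K) (dec la la_part) l_le.
have -> : \matrix_(i < N, j < N) hdiff (pvar C) (nth 0 a j) (nth 0 b i)
    (nth 0 (beta N la) i) (nth 0 (beta N mu) j) = hmat (pvar C) m fa fb K l.
  by apply/matrixP=> i j; rewrite !mxE (minn_idPl _) //; apply: nth_le_max.
rewrite -JT.
have inclE : part_incl mu la = [forall i, m i <= l i]%N.
  apply/allP/forallP => [H i | H i _].
    rewrite mE lE leq_add2r; case: (ltnP i (size mu)) => [lt_i | le_i].
      by apply: H; rewrite mem_iota.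
    by rewrite nth_default.
  case: (posnP (nth 0 mu i)) => [-> // | mu_gt0].
  have lt_i := leq_trans (nth_gt0_num_parts mu_part mu_gt0) mu_le.
  by have := H (Ordinal lt_i); rewrite mE lE leq_add2r.
rewrite /flagged_schur inclE; case: forallP => [le_ml | nincl]; last first.
  by rewrite big1 // => T /rtabP[h1 _ _ _ _ _]; case: nincl.
rewrite [RHS](reindex_onto toR fromR); last by move=> T; apply: fromRK.
apply: eq_big => [T | T _]; last by rewrite rwt_toR.
by rewrite toRK eqxx andbT toR_rtab.
Qed.

End FlaggedDeterminant.

(** * Substituting roots of unity *)

Section ConvolutionAction.
Variable R : comNzRingType.
Implicit Types (p q : {poly R}) (f : nat -> R).

(* The coefficient of z^k in p(z) * sum_i f_i z^i. *)
Definition pact p f (k : nat) : R := \sum_(i < k.+1) p`_i * f (k - i)%N.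

(** Truncating the series beyond degree k leaves this coefficient unchanged, so polynomial
    identities replace power series ones. *)
Lemma pactE p f k n : (k < n)%N -> pact p f k = (p * \poly_(i < n) f i)`_k.
Proof.
move=> lt_kn; rewrite coefM; apply: eq_bigr => i _.
by rewrite coef_poly (leq_ltn_trans (leq_subr _ _) lt_kn).
Qed.

Lemma eq_pact p f g : f =1 g -> pact p f =1 pact p g.
Proof. by move=> E k; apply: eq_bigr => i _; rewrite E. Qed.

Lemma pactM p q f : pact (p * q) f =1 pact p (pact q f).
Proof.
move=> k; rewrite (@pactE _ _ _ k.+1) // -mulrA coefM; apply: eq_bigr => i _.
by rewrite -pactE // ltnS leq_subr.
Qed.

Lemma pact_binomial (c : R) f k n : (0 < n)%N ->
  pact (1 - c *: 'X^n) f k = f k - (if (n <= k)%N then c * f (k - n)%N else 0).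
Proof.
move=> n_gt0; rewrite (@pactE _ _ _ k.+1) // mulrBl mul1r coefB coef_poly ltnSn.
congr (_ - _); rewrite -scalerAl coefZ mulrC coefXnM; case: ltnP => [_|le_nk].
  by rewrite mul0r.
by rewrite coef_poly ltnS leq_subr mulrC.
Qed.

End ConvolutionAction.

Section RootOfUnity.

Lemma prod_one_sub_scaleX (F : fieldType) (t : nat) (w : F) : t.-primitive_root w ->
  \prod_(i < t) (1 - w ^+ i *: 'X) = 1 - 'X^t :> {poly F}.
Proof.
move=> prim_w; have t_gt0 := prim_order_gt0 prim_w.
pose z := w ^+ t.-1; have wz : w * z = 1 by rewrite -exprS prednK // prim_expr_order.
have prim_z : t.-primitive_root z.
  by rewrite prim_root_exp_coprime // -{2}(prednK t_gt0) coprimenS.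
have E : \prod_(i < t) (1 - w ^+ i *: 'X) =
    (\prod_(i < t) (- w ^+ i)) *: ('X^t - 1) :> {poly F}.
  rewrite -(factor_Xn_sub_1 prim_z) big_mkord -scaler_prod; apply: eq_bigr => i _.
  by rewrite scalerBr !scaleNr opprK scale_polyC -exprMn wz expr1n addrC.
(* Evaluation at 0 determines the constant: the product of the - w^i is -1. *)
have := congr1 (fun p => p.[0]) E.
rewrite horner_prod hornerZ !hornerE expr0n gtn_eqF // sub0r mulrN1 big1; last first.
  by move=> i _; rewrite !hornerE subr0.
by move=> c1; rewrite {}E -[X in X *: _]opprK -c1 scaleN1r opprB.
Qed.

Lemma prod_one_sub_scaleX_rmorph (F : fieldType) (R : comNzRingType)
  (f : {rmorphism F -> R}) (t : nat) (w : F) (y : R) : t.-primitive_root w ->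
  \prod_(i < t) (1 - (f (w ^+ i) * y) *: 'X) = 1 - y ^+ t *: 'X^t :> {poly R}.
Proof.
move=> prim_w; pose g : {rmorphism {poly F} -> {poly R}} :=
  horner_eval (y *: 'X) \o map_poly polyC \o map_poly f.
have gX : g 'X = y *: 'X by rewrite /g /= /horner_eval !map_polyX hornerX.
have := congr1 g (prod_one_sub_scaleX prim_w).
rewrite rmorph_prod rmorphB rmorph1 rmorphXn gX exprZn => <-.
apply: eq_bigr => i _; rewrite rmorphB rmorph1; congr (_ - _).
by rewrite /g /= /horner_eval !map_polyZ !map_polyX /= hornerZ hornerX mul_polyC scalerA.
Qed.

End RootOfUnity.

Section Folding.
Variables (R : comNzRingType) (x y : nat -> R) (t : nat).
Hypothesis t_gt0 : (0 < t)%N.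
Hypothesis xy : forall c,
  \prod_(i < t) (1 - x (t * c + i)%N *: 'X) = 1 - y c *: 'X^t :> {poly R}.

Lemma hsym_rec (z : nat -> R) a b k : (a <= b)%N ->
  hsym z a b.+1 k = hsym z a b k + (if k is k'.+1 then z b * hsym z a b.+1 k' else 0).
Proof.
move=> le_ab; rewrite hsymS // big_ord_recr /= subnn expr0 mul1r addrC; congr (_ + _).
case: k => [|k]; first by rewrite big_ord0.
rewrite le_ab mulr_sumr; apply: eq_bigr => i _.
by rewrite subSn ?exprS ?mulrA // -ltnS.
Qed.

(** The generating series of the h_k is the product of the 1 / (1 - z_i X), so multiplying by these
    factors removes the last s variables. *)
Lemma pact_hsym (z : nat -> R) a b s k : (a <= b)%N ->
  pact (\prod_(i < s) (1 - z (b + i)%N *: 'X)) (hsym z a (b + s)) k = hsym z a b k.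
Proof.
move=> le_ab; elim: s k => [|s IH] k.
  rewrite big_ord0 addn0 (@pactE _ _ _ _ k.+1) // mul1r coef_poly ltnSn //.
rewrite big_ord_recr pactM -[RHS]IH; apply: eq_pact => {}k.
rewrite -[X in _ *: X]expr1 pact_binomial // addnS hsym_rec ?(leq_trans le_ab) ?leq_addr //.
by case: k => [|k]; rewrite ?subr0 ?addr0 // subn1 addrK.
Qed.

(** Removing the last block of t variables multiplies the generating series by 1 - y_b X^t. The
    resulting recursion, with steps of t in the degree, is [hsym_rec] for y with all degrees
    multiplied by t. *)
Lemma hsym_fold a b k :
  hsym x (t * a) (t * b) k = if (t %| k)%N then hsym y a b (k %/ t) else 0.
Proof.
elim: b k => [|b IH] k.
  rewrite muln0 /=; case: (boolP (t %| k)%N) => [/dvdnP[q ->]|].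
    by rewrite mulnK // muln_eq0 (gtn_eqF t_gt0) orbF.
  by case: k => [|k]; rewrite ?dvdn0.
case: (leqP a b) => [le_ab | lt_ba]; last first.
  rewrite !hsym_empty ?leq_mul2l ?lt_ba ?orbT //.
  case: (boolP (t %| k)%N) => [/dvdnP[q ->]|].
    by rewrite mulnK // muln_eq0 (gtn_eqF t_gt0) orbF.
  by case: k => [|k]; rewrite ?dvdn0.
have [n] := ubnP k; elim: n k => // n IHn k lt_k.
have le_tab : (t * a <= t * b)%N by rewrite leq_mul2l le_ab orbT.
have := pact_hsym x t k le_tab; rewrite xy pact_binomial // -mulnSr IH => /eqP.
rewrite subr_eq => /eqP ->; rewrite [in RHS]hsym_rec //.
case: (leqP t k) => [le_tk | lt_kt]; last first.
  by rewrite addr0 divn_small // addr0.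
rewrite IHn ?dvdn_subl //; last by lia.
case: (boolP (t %| k)%N) => [/dvdnP[q Ek] | _]; last by rewrite mulr0 addr0.
congr (_ + _); case: q Ek => [|q] Ek; first by lia.
by rewrite Ek mulnK // mulSn addKn mulnK.
Qed.

Lemma hdiff_fold a b p q :
  hdiff x (t * a) (t * b) p q =
  if (p %% t == q %% t)%N then hdiff y a b (p %/ t) (q %/ t) else 0.
Proof.
rewrite /hdiff hsym_fold; case: (leqP q p) => [le_qp | lt_pq].
  rewrite -(eqn_mod_dvd _ le_qp) leq_div2r //; case: eqP => // E.
  have -> : (p - q = (p %/ t - q %/ t) * t)%N.
    by rewrite [in LHS](divn_eq p t) [in LHS](divn_eq q t) E subnDr mulnBl.
  by rewrite mulnK.
case: eqP => // E; case: leqP => // le_d.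
have := divn_eq p t; have := divn_eq q t; nia.
Qed.

End Folding.

(** * Sorting beta numbers by residue *)

Section BlockDeterminant.
Variable R : comNzRingType.

Lemma det_lower_block (f : nat -> nat -> R) n1 n2 :
  (forall i j, (i < n1)%N -> (n1 <= j < n1 + n2)%N -> f i j = 0) ->
  \det (\matrix_(i < n1 + n2, j < n1 + n2) f i j) =
  \det (\matrix_(i < n1, j < n1) f i j)
    * \det (\matrix_(i < n2, j < n2) f (n1 + i)%N (n1 + j)%N).
Proof.
move=> f0; rewrite -(@det_lblock _ n1 n2 _ (\matrix_(i, j) f (n1 + i)%N j)).
congr (\det _); apply/matrixP=> i j; rewrite !mxE.
case: split_ordP => i' ->; rewrite !mxE; case: split_ordP => j' -> /=; rewrite !mxE //.
by rewrite f0 //= leq_addr ltn_add2l /=.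
Qed.

(** Vanishing above the diagonal blocks suffices: a block lower triangular matrix has the product of
    its diagonal minors as determinant. *)
Lemma det_blocks (f : nat -> nat -> R) (ms : nat -> nat) t n :
  n = (\sum_(q < t) ms q)%N ->
  (forall r i j, (r < t)%N -> (i < \sum_(q < r) ms q <= j)%N ->
     (j < \sum_(q < r.+1) ms q)%N -> f i j = 0) ->
  \det (\matrix_(i < n, j < n) f i j) =
  \prod_(r < t) \det (\matrix_(i < ms r, j < ms r)
     f (\sum_(q < r) ms q + i)%N (\sum_(q < r) ms q + j)%N).
Proof.
elim: t n => [|t IH] n ->; first by move=> _; rewrite !big_ord0 det_mx00.
move=> f0; rewrite [in RHS]big_ord_recr /= -(IH _ (erefl _)); last first.
  by move=> r i j lt_r; apply: f0; rewrite ltnS ltnW.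
rewrite -det_lower_block; last first.
  move=> i j lt_i /andP[le_j lt_j]; apply: (f0 t) => //; first by rewrite lt_i.
  by rewrite big_ord_recr.
by rewrite (big_ord_recr t).
Qed.

End BlockDeterminant.

Section Sorting.
Variables (t N : nat) (la : seq nat).
Hypothesis t_gt0 : (0 < t)%N.
Hypothesis la_part : is_partition la.

(** Indexing by natural numbers allows positions such as M_r + k without a bound proof inside the
    term; the default 0 is returned only for indices at least N. *)
Definition sorting (s : 'S_N) (i : nat) : nat := nth 0%N [seq val (s j) | j <- enum 'I_N] i.

Local Notation sg := (sorting (sigma t N la)).
Local Notation B := (nth 0%N (beta N la)).
Local Notation M := (Mres t N la).
Local Notation mr := (mres t N la).

Lemma sortingE (s : 'S_N) (i : 'I_N) : sorting s i = s i.
Proof. by rewrite /sorting (nth_map i) ?size_enum_ord // nth_ord_enum. Qed.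

Lemma Mres_full : M t = N.
Proof. by rewrite Mres_sumn (perm_size (perm_L N la t_gt0)) size_enum_ord. Qed.

Lemma Mres_le r r' : (r <= r')%N -> (M r <= M r')%N.
Proof.
move=> le_r; rewrite /Mres -!(big_mkord xpredT mr) [X in (_ <= X)%N](@big_cat_nat _ _ _ r) //=.
exact: leq_addr.
Qed.

Lemma MresS r : M r.+1 = (M r + mr r)%N.
Proof. by rewrite /Mres big_ord_recr. Qed.

Lemma block_lt r k : (r < t)%N -> (k < mr r)%N -> (M r + k < N)%N.
Proof.
move=> /Mres_le le_N lt_k; rewrite -[X in (_ < X)%N]Mres_full; apply: leq_trans le_N.
by rewrite MresS ltn_add2l.
Qed.

Lemma sorting_mod r k : (r < t)%N -> (k < mr r)%N -> (B (sg (M r + k)) %% t)%N = r.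
Proof.
move=> lt_r lt_k; have lt_N := block_lt lt_r lt_k.
have /forallP/(_ (Ordinal lt_r))/andP[/forallP/(_ (Ordinal lt_N))/implyP H _] :=
  sigmaP N t_gt0 la_part.
by rewrite (sortingE _ (Ordinal lt_N)); apply/eqP/H; rewrite /in_block /= leq_addr ltn_add2l.
Qed.

Lemma sorting_beta_lt r k k' : (r < t)%N -> (k < k' < mr r)%N ->
  (B (sg (M r + k')) < B (sg (M r + k)))%N.
Proof.
move=> lt_r /andP[lt_kk' lt_k']; have lt_k := ltn_trans lt_kk' lt_k'.
have lt_N := block_lt lt_r lt_k; have lt_N' := block_lt lt_r lt_k'.
have /forallP/(_ (Ordinal lt_r))/andP[_ /forallP/(_ (Ordinal lt_N))/forallP/(_ (Ordinal lt_N'))] :=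
  sigmaP N t_gt0 la_part.
rewrite (sortingE _ (Ordinal lt_N)) (sortingE _ (Ordinal lt_N')) => /implyP; apply.
by rewrite /in_block /= !leq_addr !ltn_add2l lt_k lt_k'.
Qed.

(** Beta numbers decrease with the index, so listing them in decreasing order within a block
    preserves the order of indices. Hence the blocks of a flag are again flags. *)
Lemma sorting_lt r k k' : (r < t)%N -> (k < k' < mr r)%N ->
  (sg (M r + k) < sg (M r + k'))%N.
Proof.
move=> lt_r /andP[lt_kk' lt_k']; have lt_k := ltn_trans lt_kk' lt_k'.
have lt_N := block_lt lt_r lt_k; have lt_N' := block_lt lt_r lt_k'.
have := @sorting_beta_lt r k k' lt_r; rewrite lt_kk' lt_k' => /(_ isT).
rewrite (sortingE _ (Ordinal lt_N)) (sortingE _ (Ordinal lt_N')).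
by rewrite (beta_lt t_gt0 la_part).
Qed.

(** Both lists are strictly decreasing, of the same length, and one is contained in the other; thus
    [tquotient] reads the entries in the order given by sigma. *)
Lemma filter_beta r : (r < t)%N ->
  [seq x <- beta N la | x %% t == r]%N = mkseq (fun k => B (sg (M r + k))) (mr r).
Proof.
move=> lt_r; set xs := filter _ _; set ys := mkseq _ _.
have gtn_trans : transitive gtn by move=> y x z /= h1 h2; apply: ltn_trans h2 h1.
have sz_xs : size xs = mr r by rewrite size_filter.
have sorted_ys : sorted gtn ys.
  apply/(sortedP 0%N) => i; rewrite size_mkseq => lt_i /=.
  rewrite [nth 0 ys i]nth_mkseq ?(ltnW lt_i) // [nth 0 ys i.+1]nth_mkseq //.
  apply: sorting_beta_lt => //.
  by rewrite ltnSn.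
have uniq_ys : uniq ys by apply: sorted_uniq sorted_ys => // x; rewrite /= ltnn.
apply: (irr_sorted_eq gtn_trans) => //; first by move=> x; rewrite /= ltnn.
  apply: sorted_filter => //; apply/(sortedP 0%N) => i; rewrite size_mkseq => lt_i /=.
  by apply: (beta_decr t_gt0 la_part); rewrite ltnSn.
suff sub : {subset ys <= xs}.
  by move=> x; rewrite (uniq_min_size uniq_ys sub _).2 // sz_xs size_mkseq.
move=> x /mapP[k]; rewrite mem_iota /= => lt_k ->.
rewrite mem_filter sorting_mod // eqxx /= mem_nth // size_mkseq.
by rewrite (sortingE _ (Ordinal (block_lt lt_r lt_k))).
Qed.

Definition qbeta (r k : nat) : nat := (B (sg (M r + k)) %/ t)%N.

Lemma qbeta_lt r k k' : (r < t)%N -> (k < k' < mr r)%N -> (qbeta r k' < qbeta r k)%N.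
Proof.
move=> lt_r lt_k; have := sorting_beta_lt lt_r lt_k; rewrite /qbeta.
have /andP[lt_kk' lt_k'] := lt_k.
rewrite {1}(divn_eq (B (sg (M r + k))) t) {1}(divn_eq (B (sg (M r + k'))) t).
by rewrite !sorting_mod ?(ltn_trans lt_kk') // ltn_add2r ltn_pmul2r.
Qed.

(** Makes the truncated subtraction in [tquotient] exact, so that the beta numbers of the quotient
    are the [qbeta r k]. *)
Lemma qbeta_ge r k : (r < t)%N -> (k < mr r)%N -> (mr r - k.+1 <= qbeta r k)%N.
Proof.
move=> lt_r lt_k; have lt_p : ((mr r).-1 < mr r)%N by lia.
have dec (i j : 'I_(mr r)) : (i < j)%N -> (qbeta r j < qbeta r i)%N.
  by move=> lt_ij; apply: qbeta_lt => //; rewrite lt_ij /=.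
have := @ltn_dec_diff _ (fun i : 'I_(mr r) => qbeta r i) (Ordinal lt_k) (Ordinal lt_p) dec.
rewrite /=; lia.
Qed.

Lemma nth_tquotient r k : (r < t)%N -> (k < mr r)%N ->
  nth 0%N (tquotient t N la r) k = (qbeta r k - (mr r - k.+1))%N.
Proof. by move=> lt_r lt_k; rewrite nth_mkseq // filter_beta // nth_mkseq. Qed.

Lemma size_tquotient r : size (tquotient t N la r) = mr r.
Proof. exact: size_mkseq. Qed.

Lemma tquotient_partition r : (r < t)%N -> is_partition (tquotient t N la r).
Proof.
move=> lt_r; apply/(sortedP 0%N) => k; rewrite size_tquotient => lt_k.
rewrite !nth_tquotient ?(ltnW lt_k) //=.
have := @qbeta_lt r k k.+1 lt_r; rewrite ltnSn lt_k => /(_ isT); lia.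
Qed.

Lemma nth_beta_tquotient r k : (r < t)%N -> (k < mr r)%N ->
  nth 0%N (beta (mr r) (tquotient t N la r)) k = qbeta r k.
Proof.
by move=> lt_r lt_k; rewrite nth_mkseq // nth_tquotient // subnK // qbeta_ge.
Qed.

Lemma num_parts_tquotient r : (num_parts (tquotient t N la r) <= mr r)%N.
Proof. by rewrite -size_tquotient; apply: count_size. Qed.

Lemma flag_blockE (s : 'S_N) (c : N.-tuple nat) r : (r < t)%N ->
  flag_block t la s c r = mkseq (fun k => nth 0 c (sorting s (M r + k)) %/ t)%N (mr r).
Proof.
move=> lt_r; rewrite /flag_block.
rewrite (eq_map (g := (fun i => nth 0 c (sorting s i) %/ t)%N \o val)); last first.
  by move=> j; rewrite /= sortingE (tnth_nth 0%N).
rewrite map_comp -(filter_map val (in_block t N la r)) val_enum_ord.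
have -> : filter (in_block t N la r) (iota 0 N) = iota (M r) (mr r).
  have le_N : (M r + mr r <= N)%N by have := Mres_le lt_r; rewrite Mres_full MresS.
  have -> : iota 0 N = iota 0 (M r) ++ iota (M r) (mr r)
      ++ iota (M r + mr r) (N - (M r + mr r)).
    by rewrite -iotaD -[X in iota X (_ + _)]add0n -iotaD; congr iota; lia.
  have nil s1 : ~~ has (in_block t N la r) s1 -> filter (in_block t N la r) s1 = [::].
    by move=> h; apply/eqP; rewrite -size_eq0 size_filter -leqn0 leqNgt -has_count.
  rewrite !filter_cat (nil (iota 0 _)); last first.
    by apply/hasPn => i; rewrite mem_iota /in_block; lia.
  rewrite (nil (iota (_ + _) _)) ?cats0 /=; last first.
    by apply/hasPn => i; rewrite mem_iota /in_block; lia.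
  by apply/all_filterP/allP => i; rewrite mem_iota.
by rewrite -[X in iota X _]addn0 iotaDl -map_comp.
Qed.

End Sorting.

(** Sorting rows by sigma_la and columns by sigma_mu costs the two signs and groups equal residues;
    with equal cores the row and column blocks have the same sizes, so the matrix becomes block
    diagonal. *)
Lemma det_residue_mx (R : comNzRingType) (t N : nat) (la mu : seq nat) (g : nat -> nat -> R) :
  (0 < t)%N -> is_partition la -> is_partition mu ->
  \det (\matrix_(i < N, j < N)
    if (nth 0 (beta N la) i %% t == nth 0 (beta N mu) j %% t)%N then g i j else 0) =
  (epsilon t N la mu)%:~R * \prod_(r < t)
    \det (\matrix_(i < mres t N la r, j < mres t N la r)
      g (sorting (sigma t N la) (Mres t N la r + i))
        (sorting (sigma t N mu) (Mres t N la r + j))).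
Proof.
move=> t_gt0 la_part mu_part; set P := \matrix_(i, j) _.
rewrite /epsilon; case: (boolP (tcore t N la == tcore t N mu)) => [/eqP core_eq | core_ne]; last first.
  rewrite mulr0n !mul0r [LHS]/determinant big1 // => s _.
  (* A Leibniz term that avoids every residue mismatch is a bijection preserving residues; it would
     force equal counts m_r and thus equal cores. *)
  case: (boolP [forall i : 'I_N,
      nth 0 (beta N la) i %% t == nth 0 (beta N mu) (s i) %% t]%N) => [/forallP sP | ].
    case/negP: core_ne; apply/eqP/tcore_eqP => // r lt_r; rewrite !mres_block !size_filter.
    rewrite -!sum1_count !big_enum_cond /= [RHS](reindex_inj (@perm_inj _ s)) /=.
    by apply: eq_bigl => i; rewrite (eqP (sP i)).
  rewrite negb_forall => /existsP[i ne]; rewrite (bigD1 i) //= mxE (negbTE ne).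
  by rewrite mul0r mulr0.
have mE r : (r < t)%N -> mres t N la r = mres t N mu r.
  by move: r; apply/tcore_eqP.
have ME r : (r <= t)%N -> Mres t N la r = Mres t N mu r.
  by move=> le_r; apply: eq_bigr => q _; rewrite mE // (leq_trans (ltn_ord q)).
pose f i j := if (nth 0 (beta N la) (sorting (sigma t N la) i) %% t ==
    nth 0 (beta N mu) (sorting (sigma t N mu) j) %% t)%N
  then g (sorting (sigma t N la) i) (sorting (sigma t N mu) j) else 0.
have -> : \det P = (-1) ^+ sigma t N la * (-1) ^+ sigma t N mu * \det (\matrix_(i < N, j < N) f i j).
  have -> : \matrix_(i < N, j < N) f i j = row_perm (sigma t N la) (col_perm (sigma t N mu) P).
    by apply/matrixP=> i j; rewrite !mxE /f !sortingE.
  rewrite row_permE col_permE !det_mulmx !det_perm odd_permV.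
  by rewrite mulrACA -signr_addb addbb mul1r mulrCA -signr_addb addbb mulr1.
rewrite mul1r rmorphM !rmorph_sign; congr (_ * _).
have EN : N = (\sum_(q < t) mres t N la q)%N by apply: esym (Mres_full N la t_gt0).
rewrite (det_blocks EN); last first.
  move=> r i j lt_r /andP[lt_i le_j] lt_j; rewrite /f.
  rewrite -/(Mres t N la r) in lt_i le_j; rewrite -/(Mres t N la r.+1) MresS in lt_j.
  have lt_iN : (i < N)%N.
    by rewrite (leq_trans lt_i) // -[X in (_ <= X)%N](Mres_full N la t_gt0) Mres_le // ltnW.
  (* Row i lies in a block q with q < r, so its residue q differs from the residue r of column j. *)
  have [q /andP[le_i lt_iq]] := in_block_ex la t_gt0 (Ordinal lt_iN).
  rewrite /= in le_i lt_iq.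
  have lt_qr : (q < r)%N.
    rewrite ltnNge; apply/negP => le_rq; have := Mres_le t N la le_rq.
    by lia.
  have -> : i = (Mres t N la q + (i - Mres t N la q))%N by rewrite subnKC.
  have -> : j = (Mres t N mu r + (j - Mres t N la r))%N by rewrite -ME ?subnKC // ltnW.
  rewrite !sorting_mod // -?mE //; try lia.
  by rewrite ltn_eqF.
apply: eq_bigr => r _; congr (\det _); apply/matrixP=> i j; rewrite !mxE /f.
rewrite -/(Mres t N la r) sorting_mod // ME ?(ltnW (ltn_ord r)) // sorting_mod -?mE //.
by rewrite eqxx.
Qed.

(** * Specialising the Jacobi-Trudi matrix and recognising the t-quotients *)

HB.instance Definition _ (C : comNzRingType) (v : nat -> inf_poly C) :=
  GRing.RMorphism.copy (psubst v) (mmap (fun c : C => c%:MP) (cm_eval v)).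

(** The c-th block of t variables becomes the omega^i y_c, and the product of the 1 - omega^i y_c X
    is 1 - y_c^t X^t; this is the hypothesis of [hdiff_fold], with y_c^t as the folded variable. *)
Lemma phi_hdiff (C : fieldType) (t : nat) (omega : C) a b p q :
  t.-primitive_root omega ->
  phi t omega (hdiff (pvar C) (t * a) (t * b) p q) =
  if (p %% t == q %% t)%N then x_to_y t (hdiff (pvar C) a b (p %/ t) (q %/ t)) else 0.
Proof.
move=> prim; have t_gt0 := prim_order_gt0 prim.
pose x i : inf_poly C := omega ^+ (i %% t) *: pvar C (i %/ t).
have -> : phi t omega (hdiff (pvar C) (t * a) (t * b) p q) = hdiff x (t * a) (t * b) p q.
  by rewrite /phi rmorph_hdiff; apply: eq_hdiff => i; rewrite /= psubst_var.
have -> : x_to_y t (hdiff (pvar C) a b (p %/ t) (q %/ t)) =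
    hdiff (fun c => pvar C c ^+ t) a b (p %/ t) (q %/ t).
  by rewrite /x_to_y rmorph_hdiff; apply: eq_hdiff => i; rewrite /= psubst_var.
apply: hdiff_fold => // c.
rewrite -(prod_one_sub_scaleX_rmorph (@malgC _ C) (pvar C c) prim); apply: eq_bigr => i _.
rewrite /x mulnC modnMDl divnMDl // modn_small // divn_small // addn0.
by rewrite mul_malgC.
Qed.

Lemma num_parts_iota la k : (size la <= k)%N ->
  num_parts la = count (fun i => 0 < nth 0 la i)%N (iota 0 k).
Proof.
move=> le_k; rewrite /num_parts -{1}(mkseq_nth 0%N la) count_map.
rewrite -(subnKC le_k) iotaD count_cat [X in (_ + X)%N](_ : _ = 0%N) ?addn0 //.
apply/eqP; rewrite -leqn0 leqNgt -has_count; apply/hasPn => i; rewrite mem_iota => /andP[le_i _].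
by rewrite nth_default.
Qed.

Lemma num_parts_incl mu la : part_incl mu la -> (num_parts mu <= num_parts la)%N.
Proof.
move=> /allP incl; pose k := maxn (size mu) (size la).
rewrite (@num_parts_iota mu k) ?leq_maxl // (@num_parts_iota la k) ?leq_maxr //.
apply: sub_count => i /= gt0; apply: leq_trans gt0 _.
case: (ltnP i (size mu)) => [lt_i | le_i]; first by apply: incl; rewrite mem_iota.
by rewrite nth_default.
Qed.

(** The labels of the quotients are the sorted beta numbers divided by t, and the block flags are
    the entries of a and b at the same sorted columns and rows; so the diagonal block is the
    Jacobi-Trudi matrix of the quotients. *)
Theorem flagged_schur_tquotient (C : comNzRingType) (t N : nat) (la mu : seq nat)
    (a b : N.-tuple nat) (r : nat) :
  (0 < t)%N -> is_partition la -> is_partition mu ->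
  (forall q, (q < t)%N -> mres t N la q = mres t N mu q) ->
  is_flag a -> is_flag b -> (r < t)%N ->
  flagged_schur C (tquotient t N la r) (tquotient t N mu r)
    (flag_block t la (sigma t N mu) a r) (flag_block t la (sigma t N la) b r) =
  \det (\matrix_(i < mres t N la r, j < mres t N la r)
    (fun i j => hdiff (pvar C) (nth 0 a j %/ t) (nth 0 b i %/ t)
       (nth 0 (beta N la) i %/ t) (nth 0 (beta N mu) j %/ t))
      (sorting (sigma t N la) (Mres t N la r + i))
      (sorting (sigma t N mu) (Mres t N la r + j)))%N.
Proof.
move=> t_gt0 la_part mu_part mE a_flag b_flag lt_r.
have ME : Mres t N la r = Mres t N mu r.
  by apply: eq_bigr => q _; rewrite mE // (ltn_trans (ltn_ord q)).
have fl nu (c : N.-tuple nat) : is_partition nu -> is_flag c ->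
    mres t N nu r = mres t N la r -> Mres t N nu r = Mres t N la r ->
    is_flag (flag_block t la (sigma t N nu) c r).
  move=> nu_part c_flag Em EM; apply/(sortedP 0%N) => i.
  rewrite flag_blockE // size_mkseq => lt_i; rewrite !nth_mkseq ?(ltnW lt_i) //.
  apply: leq_div2r; apply: nth_flag => //; rewrite -EM size_tuple.
  have lt_i' : (i.+1 < mres t N nu r)%N by rewrite Em.
  rewrite ltnW; last by apply: sorting_lt; rewrite // ltnSn.
  by rewrite (sortingE _ (Ordinal (block_lt t_gt0 lt_r lt_i'))) /=.
rewrite (@flagged_schur_det C (mres t N la r)); first last.
- by rewrite flag_blockE // size_mkseq.
- by rewrite flag_blockE // size_mkseq.
- exact: fl.
- by apply: fl; rewrite ?mE.
- by rewrite mE //; apply: num_parts_tquotient.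
- exact: num_parts_tquotient.
- exact: tquotient_partition.
- exact: tquotient_partition.
congr (\det _); apply/matrixP=> i j; rewrite !mxE.
rewrite nth_beta_tquotient // [X in beta X _]mE // nth_beta_tquotient -?mE // /qbeta -ME.
by rewrite !flag_blockE // [nth 0 (mkseq _ _) j]nth_mkseq // [nth 0 (mkseq _ _) i]nth_mkseq.
Qed.

Theorem mainTheorem2 (C : numClosedFieldType) (n t : nat) (omega : C)
    (la mu : seq nat) (a b : (t * n).-tuple nat) :
  (0 < n)%N -> (0 < t)%N ->
  t.-primitive_root omega ->
  is_partition la -> is_partition mu -> part_incl mu la ->
  (num_parts la <= t * n)%N ->
  is_flag a -> is_flag b ->
  (forall i, t %| tnth a i)%N -> (forall i, t %| tnth b i)%N ->
  phi t omega (flagged_schur C la mu a b) =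
  x_to_y t
    ((epsilon t (t * n) la mu)%:~R *
     \prod_(r < t)
        flagged_schur C (tquotient t (t * n) la r) (tquotient t (t * n) mu r)
          (flag_block t la (sigma t (t * n) mu) a r)
          (flag_block t la (sigma t (t * n) la) b r)).
Proof.
move=> _ t_gt0 prim la_part mu_part incl la_le a_flag b_flag a_dvd b_dvd.
have mu_le := leq_trans (num_parts_incl incl) la_le.
have dvd (c : (t * n).-tuple nat) (i : 'I_(t * n)) : (forall i, t %| tnth c i)%N ->
    nth 0%N c i = (t * (nth 0 c i %/ t))%N.
  by move=> /(_ i); rewrite (tnth_nth 0%N) => /divnK; rewrite mulnC.
rewrite (flagged_schur_det C la_part mu_part la_le mu_le a_flag b_flag (size_tuple a) (size_tuple b)).
set g := fun i j => hdiff (pvar C) (nth 0%N a j %/ t) (nth 0%N b i %/ t)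
   (nth 0%N (beta (t * n) la) i %/ t) (nth 0%N (beta (t * n) mu) j %/ t).
pose ph : {rmorphism inf_poly C -> inf_poly C} :=
  psubst (fun i => omega ^+ (i %% t) *: pvar C (i %/ t)).
pose xy : {rmorphism inf_poly C -> inf_poly C} := psubst (fun i => pvar C i ^+ t).
set A := \matrix_(i, j) _.
pose P : 'M[inf_poly C]_(t * n) := \matrix_(i, j)
  if (nth 0 (beta (t * n) la) i %% t == nth 0 (beta (t * n) mu) j %% t)%N then g i j else 0.
have AE i j : A i j = hdiff (pvar C) (t * (nth 0 a j %/ t)) (t * (nth 0 b i %/ t))
    (nth 0 (beta (t * n) la) i) (nth 0 (beta (t * n) mu) j).
  by rewrite mxE -(dvd a j a_dvd) -(dvd b i b_dvd).
have E i j : phi t omega (A i j) = x_to_y t (P i j).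
  rewrite AE phi_hdiff //.
  rewrite [P i j]mxE.
  case: ifP => // _.
  exact: esym (rmorph0 xy).
have {}E : map_mx ph A = map_mx xy P by apply/matrixP=> i j; rewrite [LHS]mxE [RHS]mxE; apply: E.
(* Both substitutions are ring morphisms, so they commute with determinants and the entrywise
   identity suffices. *)
transitivity (x_to_y t (\det P)).
  exact: etrans (esym (det_map_mx ph A)) (etrans (congr1 determinant E) (det_map_mx xy P)).
apply: (congr1 (x_to_y t)).
apply: etrans (det_residue_mx (t * n) g t_gt0 la_part mu_part) _.
rewrite /epsilon.
(* With different cores the factor epsilon is 0 on both sides; equal cores give the equal m_r needed
   to identify the blocks. *)
case: (boolP (tcore t (t * n) la == tcore t (t * n) mu)) => [/eqP core_eq | _]; last first.
  by rewrite mulr0n !mul0r.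
apply: (congr1 (fun z => _ * z)); apply: eq_bigr => r _.
have mE q : (q < t)%N -> mres t (t * n) la q = mres t (t * n) mu q.
  by move: q; apply/tcore_eqP.
exact: esym (flagged_schur_tquotient C t_gt0 la_part mu_part mE a_flag b_flag (ltn_ord r)).
Qed.
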